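(* Let $G_1,\dots,G_6$ be the groups defined by the presentations $$G_1=\langle a,t_1,t_2\mid a^2=t_1,\ [t_1,t_2]=1,\ at_2a^{-1}=t_2^{-1}\rangle,$$ $$G_2=\langle c,t_1,t_2\mid c^2=1,\ [t_1,t_2]=1,\ ct_1c^{-1}=t_1^{-1},\ ct_2c^{-1}=t_2^{-1}\rangle,$$ $$G_3=\langle c,t_1,t_2\mid c^3=1,\ [t_1,t_2]=1,\ ct_1c^{-1}=t_2,\ ct_2c^{-1}=t_1^{-1}t_2^{-1}\rangle,$$ $$G_4=\langle c,t_1,t_2\mid c^4=1,\ [t_1,t_2]=1,\ ct_1c^{-1}=t_2,\ ct_2c^{-1}=t_1^{-1}\rangle,$$ $$G_5=\langle c,t_1,t_2\mid c^6=1,\ [t_1,t_2]=1,\ ct_1c^{-1}=t_2,\ ct_2c^{-1}=t_1^{-1}t_2\rangle,$$ $$G_6=\langle a,c,t_1,t_2\mid a^2=t_1,\ [t_1,t_2]=1,\ at_2a^{-1}=t_2^{-1},\ c^2=1,\ ct_1c^{-1}=t_1^{-1},\ ct_2c^{-1}=t_2^{-1},\ cac^{-1}=t_2a^{-1}\rangle.$$ For each $i$, let $H_i=\langle t_1,t_2\rangle\le G_i$. Then $H_i$ is free abelian of rank 2 and of finite index in $G_i$. Moreover the following hold, where $n_1,n_2\in\mathbb{Z}$ and $\mathcal{Z}(u)$ denotes the centralizer in $G_i$ of a nontrivial element $u\in G_i$. **$G_1$.** Every element of $G_1$ can be written in a unique way in the form $t_1^{n_1}t_2^{n_2}$ or $t_1^{n_1}t_2^{n_2}a$.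 For nontrivial $u$: - if $u=t_1^{n_1}t_2^{n_2}\in H_1$, then $\mathcal{Z}(u)=G_1$ (isomorphic to the fundamental group of the Klein bottle) if $u\in\langle t_1\rangle$, and $\mathcal{Z}(u)=H_1\cong\mathbb{Z}\oplus\mathbb{Z}$ if $u\notin\langle t_1\rangle$; - if $u=t_1^{n_1}t_2^{n_2}a$, then $\mathcal{Z}(u)=\langle t_2^{n_2}a\rangle$. **$G_2$.** Every element of $G_2$ can be written in a unique way in the form $t_1^{n_1}t_2^{n_2}$ or $t_1^{n_1}t_2^{n_2}c$. For nontrivial $u$: - if $u=t_1^{n_1}t_2^{n_2}\in H_2$, then $\mathcal{Z}(u)=H_2\cong\mathbb{Z}\oplus\mathbb{Z}$; - if $u=t_1^{n_1}t_2^{n_2}c$, then $\mathcal{Z}(u)=\langle u\rangle$. **$G_3$.** Every element of $G_3$ can be written in a unique way in the form $t_1^{n_1}t_2^{n_2}c^k$ with $k\in\{0,1,2\}$. For nontrivial $u$: - if $u=t_1^{n_1}t_2^{n_2}\in H_3$, then $\mathcal{Z}(u)=H_3\cong\mathbb{Z}\oplus\mathbb{Z}$; - if $u=t_1^{n_1}t_2^{n_2}c$, then $\mathcal{Z}(u)=\langle u\rangle$; - if $u=t_1^{n_1}t_2^{n_2}c^2$, then $\mathcal{Z}(u)=\langle t_1^{n_2}t_2^{n_2-n_1}c\rangle$. **$G_4$.** Every element of $G_4$ can be written in a unique way in the form $t_1^{n_1}t_2^{n_2}c^k$ with $k\in\{0,1,2,3\}$. For nontrivial $u$: - if $u=t_1^{n_1}t_2^{n_2}\in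 H_4$, then $\mathcal{Z}(u)=H_4\cong\mathbb{Z}\oplus\mathbb{Z}$; - if $u=t_1^{n_1}t_2^{n_2}c$, then $\mathcal{Z}(u)=\langle u\rangle$; - if $u=t_1^{n_1}t_2^{n_2}c^2$, then $\mathcal{Z}(u)=\langle t_1^{(n_1+n_2)/2}t_2^{(n_2-n_1)/2}c\rangle$ if $n_1+n_2$ is even, and $\mathcal{Z}(u)=\langle u\rangle$ otherwise; - if $u=t_1^{n_1}t_2^{n_2}c^3$, then $\mathcal{Z}(u)=\langle t_1^{n_2}t_2^{-n_1}c\rangle$. **$G_5$.** Every element of $G_5$ can be written in a unique way in the form $t_1^{n_1}t_2^{n_2}c^k$ with $k\in\{0,1,2,3,4,5\}$. For nontrivial $u$: - if $u=t_1^{n_1}t_2^{n_2}\in H_5$, then $\mathcal{Z}(u)=H_5\cong\mathbb{Z}\oplus\mathbb{Z}$; - if $u=t_1^{n_1}t_2^{n_2}c$, then $\mathcal{Z}(u)=\langle u\rangle$; - if $u=t_1^{n_1}t_2^{n_2}c^2$, then $\mathcal{Z}(u)=\langle t_1^{(2n_1+n_2)/3}t_2^{(n_2-n_1)/3}c\rangle$ if $3$ divides $n_1-n_2$, and $\mathcal{Z}(u)=\langle u\rangle$ otherwise; - if $u=t_1^{n_1}t_2^{n_2}c^3$, then $\mathcal{Z}(u)=\langle t_1^{(n_1+n_2)/2}t_2^{-n_1/2}c\rangle$ if $n_1$ and $n_2$ are both even, and $\mathcal{Z}(u)=\langle u\rangle$ otherwise; - if $u=t_1^{n_1}t_2^{n_2}c^4$,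 then $\mathcal{Z}(u)=\langle t_1^{(n_1+2n_2)/3}t_2^{-(2n_1+n_2)/3}c\rangle$ if $3$ divides $n_1-n_2$, and $\mathcal{Z}(u)=\langle t_1^{n_1+n_2}t_2^{-n_1}c^2\rangle$ otherwise; - if $u=t_1^{n_1}t_2^{n_2}c^5$, then $\mathcal{Z}(u)=\langle t_1^{n_2}t_2^{-(n_1+n_2)}c\rangle$. **$G_6$.** Every element of $G_6$ can be written in a unique way in one of the forms $t_1^{n_1}t_2^{n_2}$, $t_1^{n_1}t_2^{n_2}a$, $t_1^{n_1}t_2^{n_2}c$, $t_1^{n_1}t_2^{n_2}ac$. Let $K_6=\langle a,t_1,t_2\rangle\le G_6$; it is isomorphic to the fundamental group of the Klein bottle. For nontrivial $u$: - if $u=t_1^{n_1}t_2^{n_2}\in H_6$, then $\mathcal{Z}(u)=\langle ac,t_1\rangle$ (isomorphic to the fundamental group of the Klein bottle) if $u\in\langle t_2\rangle$; $\mathcal{Z}(u)=K_6$ if $u\in\langle t_1\rangle$; and $\mathcal{Z}(u)=H_6\cong\mathbb{Z}\oplus\mathbb{Z}$ otherwise; - if $u=t_1^{n_1}t_2^{n_2}a$, then $\mathcal{Z}(u)=\langle t_2^{n_2}a\rangle$; - if $u=t_1^{n_1}t_2^{n_2}c$, then $\mathcal{Z}(u)=\langle u\rangle$; - if $u=t_1^{n_1}t_2^{n_2}ac$, then $\mathcal{Z}(u)=\langle t_1^{n_1}ac\rangle$.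
   Context: $[x,y]$ denotes the commutator $xyx^{-1}y^{-1}$. $\langle S\rangle$ denotes the subgroup generated by $S$. The fundamental group of the Klein bottle is $\langle x,y\mid x^2y^2=1\rangle$. *)

(* Defs.v *)
From HB Require Import structures.
From mathcomp Require Import all_boot all_algebra.
From mathcomp Require Import boolp classical_sets functions cardinality.

Set Implicit Arguments.
Unset Strict Implicit.
Unset Printing Implicit Defensive.

Local Open Scope classical_set_scope.
Local Open Scope group_scope.

(* [x, y] = x y x^-1 y^-1, which is not MathComp's [~ x, y] = x^-1 y^-1 x y. *)
Definition commutator (G : baseGroupType) (x y : G) : G := x * y * x^-1 * y^-1.

(* The group presented by generators X and a set R of relations, where the
   pair (s, t) stands for the relation s = t: group terms in the generators,
   modulo the least congruence containing the group axioms and R. *)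

Inductive gterm (X : Type) : Type :=
  | gVar of X
  | gOne
  | gMul of gterm X & gterm X
  | gInv of gterm X.
Arguments gOne {X}.

HB.instance Definition _ (X : Type) := gen_eqMixin (gterm X).
HB.instance Definition _ (X : Type) := gen_choiceMixin (gterm X).
(* These give terms the notations of group_scope; no group axiom holds yet. *)
HB.instance Definition _ (X : Type) := hasMul.Build (gterm X) (@gMul X).
HB.instance Definition _ (X : Type) := hasOne.Build (gterm X) gOne.
HB.instance Definition _ (X : Type) := hasInv.Build (gterm X) (@gInv X).

Section Presentation.
Variables (X : Type) (R : set (gterm X * gterm X)).

Inductive pres_eq : gterm X -> gterm X -> Prop :=
  | pres_rel s t : R (s, t) -> pres_eq s t
  | pres_mulA s t u : pres_eq (s * (t * u)) (s * t * u)
  | pres_mul1l s : pres_eq (1 * s) s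
  | pres_mul1r s : pres_eq (s * 1) s
  | pres_mulVl s : pres_eq (s^-1 * s) 1
  | pres_mulVr s : pres_eq (s * s^-1) 1
  | pres_mul s s' t t' : pres_eq s s' -> pres_eq t t' -> pres_eq (s * t) (s' * t')
  | pres_inv s s' : pres_eq s s' -> pres_eq s^-1 s'^-1
  | pres_refl s : pres_eq s s
  | pres_sym s t : pres_eq s t -> pres_eq t s
  | pres_trans s t u : pres_eq s t -> pres_eq t u -> pres_eq s u.

Definition pres_eqb : rel (gterm X) := fun s t => `[< pres_eq s t >].

Lemma pres_eqb_equiv : equiv_class_of pres_eqb.
Proof.
split.
- by move=> s; apply/asboolP/pres_refl.
- by move=> s t; apply/asboolP/asboolP; apply: pres_sym.
- move=> t s u /asboolP st /asboolP tu; apply/asboolP; exact: pres_trans st tu.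
Qed.

Canonical pres_equiv_rel := EquivRelPack pres_eqb_equiv.

Definition presented : Type := {eq_quot pres_eqb}%qT.
HB.instance Definition _ := Choice.on presented.
HB.instance Definition _ := EqQuotient.on presented.

Definition pres_class (s : gterm X) : presented := (\pi_presented s)%qT.
Definition pgen (x : X) : presented := pres_class (gVar x).

Lemma pres_classP s t : pres_class s = pres_class t <-> pres_eq s t.
Proof.
split=> [/eqquotP/asboolP //|st]; exact/eqquotP/asboolP.
Qed.

Lemma pres_class_repr (x : presented) : pres_class (repr x) = x.
Proof. exact: reprK. Qed.

Definition pres_mulq (x y : presented) := pres_class (repr x * repr y).
Definition pres_invq (x : presented) := pres_class (repr x)^-1.

Lemma pres_mulqE s t : pres_mulq (pres_class s) (pres_class t) = pres_class (s * t).
Proof.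
by apply/pres_classP; apply: pres_mul; apply/pres_classP; rewrite pres_class_repr.
Qed.

Lemma pres_invqE s : pres_invq (pres_class s) = pres_class s^-1.
Proof.
by apply/pres_classP; apply: pres_inv; apply/pres_classP; rewrite pres_class_repr.
Qed.

Fact pres_mulqA : associative pres_mulq.
Proof.
move=> x y z; rewrite -[x]pres_class_repr -[y]pres_class_repr -[z]pres_class_repr.
by rewrite !pres_mulqE; apply/pres_classP/pres_mulA.
Qed.

Fact pres_mul1q : left_id (pres_class 1) pres_mulq.
Proof.
by move=> x; rewrite -[x]pres_class_repr pres_mulqE; apply/pres_classP/pres_mul1l.
Qed.

Fact pres_mulq1 : right_id (pres_class 1) pres_mulq.
Proof.
by move=> x; rewrite -[x]pres_class_repr pres_mulqE; apply/pres_classP/pres_mul1r.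
Qed.

Fact pres_mulVq : left_inverse (pres_class 1) pres_invq pres_mulq.
Proof.
move=> x; rewrite -[x]pres_class_repr pres_invqE pres_mulqE.
exact/pres_classP/pres_mulVl.
Qed.

Fact pres_mulqV : right_inverse (pres_class 1) pres_invq pres_mulq.
Proof.
move=> x; rewrite -[x]pres_class_repr pres_invqE pres_mulqE.
exact/pres_classP/pres_mulVr.
Qed.

HB.instance Definition _ := isGroup.Build presented
  pres_mulqA pres_mul1q pres_mulq1 pres_mulVq pres_mulqV.

Lemma pres_classM s t : pres_class (s * t) = pres_class s * pres_class t.
Proof. by rewrite -pres_mulqE. Qed.

Lemma pres_classV s : pres_class s^-1 = (pres_class s)^-1.
Proof. by rewrite -pres_invqE. Qed.

Lemma pres_class1 : pres_class 1 = 1.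
Proof. by []. Qed.

Fixpoint gterm_eval (G : groupType) (f : X -> G) (s : gterm X) : G :=
  match s with
  | gVar x => f x
  | gOne => 1
  | gMul s t => gterm_eval f s * gterm_eval f t
  | gInv s => (gterm_eval f s)^-1
  end.

Lemma gterm_eval_pgen s : gterm_eval pgen s = pres_class s.
Proof. by elim: s => //= [s -> t ->|s ->]; rewrite -?pres_classM -?pres_classV. Qed.

Lemma presented_rel s t : R (s, t) -> gterm_eval pgen s = gterm_eval pgen t.
Proof. by move=> Rst; rewrite !gterm_eval_pgen; apply/pres_classP/pres_rel. Qed.

Lemma gterm_eval_eq (G : groupType) (f : X -> G) s t :
  (forall r, R r -> gterm_eval f r.1 = gterm_eval f r.2) ->
  pres_eq s t -> gterm_eval f s = gterm_eval f t.
Proof.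
move=> fR; elim=> {s t} /=.
- by move=> s t /fR.
- by move=> s t u; rewrite mulgA.
- by move=> s; rewrite mul1g.
- by move=> s; rewrite mulg1.
- by move=> s; rewrite mulVg.
- by move=> s; rewrite mulgV.
- by move=> s s' t t' _ -> _ ->.
- by move=> s s' _ ->.
- by [].
- by [].
- by move=> s t u _ -> _ ->.
Qed.

Lemma presented_lift (G : groupType) (f : X -> G) :
  (forall r, R r -> gterm_eval f r.1 = gterm_eval f r.2) ->
  exists phi : {multiplicative presented -> G}, forall x, phi (pgen x) = f x.
Proof.
move=> fR; pose phi (x : presented) := gterm_eval f (repr x).
have phiE s : phi (pres_class s) = gterm_eval f s.
  by apply: gterm_eval_eq => //; apply/pres_classP; rewrite pres_class_repr.
have phiM : {morph phi : x y / x * y}.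
  by move=> x y; rewrite -[x]pres_class_repr -[y]pres_class_repr -pres_classM !phiE.
pose phim := isMultiplicative.Build _ _ phi phiM.
exists (HB.pack_for {multiplicative presented -> G} phi phim) => x.
exact: phiE.
Qed.

End Presentation.

Section Subgroups.
Variable G : groupType.

Definition is_subgroup (H : set G) : Prop :=
  [/\ H 1, forall x y, H x -> H y -> H (x * y) & forall x, H x -> H x^-1].

Definition generated (S : set G) : set G := smallest is_subgroup S.

Definition centralizer (u : G) : set G := [set g | commute g u].

Definition finite_index (H : set G) : Prop :=
  finite_set (range (fun g : G => [set g * h | h in H])).

Definition isomorphic_to (K : groupType) (A : set G) : Prop :=
  exists f : {multiplicative K -> G}, injective f /\ range f = A.

Definition free_abelian_of_rank (n : nat) (A : set G) : Prop :=
  isomorphic_to (Algebra.to_multiplicative 'rV[int]_n) A.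

Definition zexpg (x : G) (n : int) : G :=
  match n with Posz m => x ^+ m | Negz m => x ^- m.+1 end.

(* Every g is t1^n1 t2^n2 s_k for exactly one triple (n1, n2, k); in
   particular distinct positions k in s give distinct forms. *)
Definition unique_form (t1 t2 : G) (s : seq G) : Prop :=
  forall g : G, exists! p : int * int * 'I_(size s),
    g = zexpg t1 p.1.1 * zexpg t2 p.1.2 * s`_p.2.

End Subgroups.

Arguments zexpg {G} x%_g n%_R.
Notation "x ^^ n" := (zexpg x n)
  (at level 29, n at level 28, left associativity) : group_scope.

Definition ZxZ : groupType := Algebra.to_multiplicative (int * int)%type.

Variant gens_xy := xy_x | xy_y.
Variant gens_a := a_a | a_t1 | a_t2.
Variant gens_c := c_c | c_t1 | c_t2.
Variant gens_ac := ac_a | ac_c | ac_t1 | ac_t2.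

Definition klein_rels : set (gterm gens_xy * gterm gens_xy) :=
  let x := gVar xy_x in let y := gVar xy_y in
  [set (x ^+ 2 * y ^+ 2, 1)].

Definition rels1 : set (gterm gens_a * gterm gens_a) :=
  let a := gVar a_a in let t1 := gVar a_t1 in let t2 := gVar a_t2 in
  [set (a ^+ 2, t1); (commutator t1 t2, 1); (a * t2 * a^-1, t2^-1)].

Definition rels2 : set (gterm gens_c * gterm gens_c) :=
  let c := gVar c_c in let t1 := gVar c_t1 in let t2 := gVar c_t2 in
  [set (c ^+ 2, 1); (commutator t1 t2, 1);
       (c * t1 * c^-1, t1^-1); (c * t2 * c^-1, t2^-1)].

Definition rels3 : set (gterm gens_c * gterm gens_c) :=
  let c := gVar c_c in let t1 := gVar c_t1 in let t2 := gVar c_t2 in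
  [set (c ^+ 3, 1); (commutator t1 t2, 1);
       (c * t1 * c^-1, t2); (c * t2 * c^-1, t1^-1 * t2^-1)].

Definition rels4 : set (gterm gens_c * gterm gens_c) :=
  let c := gVar c_c in let t1 := gVar c_t1 in let t2 := gVar c_t2 in
  [set (c ^+ 4, 1); (commutator t1 t2, 1);
       (c * t1 * c^-1, t2); (c * t2 * c^-1, t1^-1)].

Definition rels5 : set (gterm gens_c * gterm gens_c) :=
  let c := gVar c_c in let t1 := gVar c_t1 in let t2 := gVar c_t2 in
  [set (c ^+ 6, 1); (commutator t1 t2, 1);
       (c * t1 * c^-1, t2); (c * t2 * c^-1, t1^-1 * t2)].

Definition rels6 : set (gterm gens_ac * gterm gens_ac) :=
  let a := gVar ac_a in let c := gVar ac_c in
  let t1 := gVar ac_t1 in let t2 := gVar ac_t2 in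
  [set (a ^+ 2, t1); (commutator t1 t2, 1); (a * t2 * a^-1, t2^-1);
       (c ^+ 2, 1); (c * t1 * c^-1, t1^-1); (c * t2 * c^-1, t2^-1);
       (c * a * c^-1, t2 * a^-1)].

Definition klein_group : groupType := presented klein_rels.
Definition G1 : groupType := presented rels1.
Definition G2 : groupType := presented rels2.
Definition G3 : groupType := presented rels3.
Definition G4 : groupType := presented rels4.
Definition G5 : groupType := presented rels5.
Definition G6 : groupType := presented rels6.

(* Main.v *)
Require Import Defs.
From HB Require Import structures.
From mathcomp Require Import all_boot all_algebra.
From mathcomp Require Import boolp classical_sets functions cardinality.
From mathcomp Require Import zify ring.

Set Implicit Arguments.
Unset Strict Implicit.
Unset Printing Implicit Defensive.

Local Open Scope classical_set_scope.
Local Open Scope group_scope.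

(* Each group acts on the plane by integral affine maps, with t1 and t2 acting
   as the translations by (2, 0) and (0, 2); the factor 2 makes room for the
   half-translations of the glides a.  The defining relations rewrite every
   element as t1^n1 t2^n2 x with x in the given list of representatives, and
   as the representatives have distinct linear parts this representation is
   faithful.  Normal forms are thus unique, and commutation becomes a system of
   linear equations over the integers.

   For the centralizer of u: if g commutes with u and has the linear part of a
   power w^i of the claimed generator w, then g w^-i is a translation commuting
   with u, and these are easily determined.  The remaining linear parts are
   excluded because the equations have no integral solution. *)

(** * Integer powers, lattices and subgroups *)

Section IntegerPowers.
Variables G : groupType.
Implicit Types (x y : G) (m n : int).

Lemma zexpgSr x n : x ^^ (n + 1) = x ^^ n * x.
Proof.
case: n => [n|[|n]].
- have -> : (Posz n + 1 = Posz n.+1)%R by lia.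
  exact: expgSr.
- by rewrite /= mulVg.
- have -> : (Negz n.+1 + 1 = Negz n)%R by lia.
  by rewrite /= [in RHS]expgS invgM mulgVK.
Qed.

Lemma zexpgBr1 x n : x ^^ (n - 1) = x ^^ n * x^-1.
Proof. by rewrite -{2}[n](GRing.subrK 1%R) zexpgSr mulgK. Qed.

Lemma zexpgDr x m n : x ^^ (m + n) = x ^^ m * x ^^ n.
Proof.
elim/int_ind: n => [|n IH|n IH].
- by rewrite GRing.addr0 mulg1.
- by rewrite -addn1 PoszD GRing.addrA !zexpgSr IH mulgA.
- by rewrite -addn1 PoszD GRing.opprD GRing.addrA !zexpgBr1 IH mulgA.
Qed.

Lemma zexpgN x n : x ^^ (- n) = (x ^^ n)^-1.
Proof. by apply/esym/mulg1_eq; rewrite -zexpgDr GRing.subrr. Qed.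

Lemma zexpgM x m n : x ^^ (m * n) = x ^^ m ^^ n.
Proof.
elim/int_ind: n => [|n IH|n IH].
- by rewrite GRing.mulr0.
- by rewrite -addn1 PoszD GRing.mulrDr GRing.mulr1 zexpgSr zexpgDr IH.
- rewrite -addn1 PoszD GRing.opprD GRing.mulrDr GRing.mulrN1.
  by rewrite zexpgDr IH [in RHS]zexpgBr1 [x ^^ (- m)]zexpgN.
Qed.

Lemma zexpVg x n : x^-1 ^^ n = x ^^ (- n).
Proof.
have -> : x^-1 = x ^^ (-1) by [].
by rewrite -zexpgM GRing.mulN1r.
Qed.

Lemma commute_zexpg x y n : commute x y -> commute x (y ^^ n).
Proof.
by case: n => n xy /=; [exact: commuteX | apply/commuteV/commuteX].
Qed.

Lemma zexpgMl x y n : commute x y -> (x * y) ^^ n = x ^^ n * y ^^ n.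
Proof.
case: n => n xy /=; first exact: expgMn.
rewrite expgMn // invgM; apply/commute_sym/commuteV/commute_sym/commuteV.
exact: commuteX2.
Qed.

End IntegerPowers.

(* [{multiplicative G -> H}] records preservation of products only. *)
Section GroupMorphisms.
Variables (G H : groupType) (f : G -> H).
Hypothesis fM : {morph f : x y / x * y}.

Lemma morph_one : f 1 = 1.
Proof. by apply: (@mulgI _ (f 1)); rewrite -fM !mulg1. Qed.

Lemma morph_inv x : f x^-1 = (f x)^-1.
Proof. by apply/esym/mulg1_eq; rewrite -fM mulgV morph_one. Qed.

Lemma morph_expg x n : f (x ^+ n) = f x ^+ n.
Proof. by elim: n => [|n IH]; rewrite ?morph_one // !expgS fM IH. Qed.

Lemma morph_zexpg x n : f (x ^^ n) = f x ^^ n.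
Proof. by case: n => n /=; rewrite ?morph_inv morph_expg. Qed.

Lemma morph_injective : (forall x, f x = 1 -> x = 1) -> injective f.
Proof.
by move=> f1 x y xy; apply/divg1_eq/f1; rewrite fM morph_inv xy mulgV.
Qed.

End GroupMorphisms.

Section Lattice.
Variables (G : groupType) (t1 t2 : G).
Hypothesis t12 : commute t1 t2.

Lemma latM m1 m2 n1 n2 :
  (t1 ^^ m1 * t2 ^^ m2) * (t1 ^^ n1 * t2 ^^ n2) =
  t1 ^^ (m1 + n1) * t2 ^^ (m2 + n2).
Proof.
have tt : commute (t2 ^^ m2) (t1 ^^ n1).
  by apply/commute_zexpg/commute_sym/commute_zexpg.
by rewrite !zexpgDr -!mulgA; congr (_ * _); rewrite !mulgA tt.
Qed.

Lemma latX m1 m2 n :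
  (t1 ^^ m1 * t2 ^^ m2) ^^ n = t1 ^^ (m1 * n) * t2 ^^ (m2 * n).
Proof.
rewrite zexpgMl ?zexpgM //.
by apply/commute_zexpg/commute_sym/commute_zexpg/commute_sym.
Qed.

Lemma latV n1 n2 : (t1 ^^ n1 * t2 ^^ n2)^-1 = t1 ^^ (- n1) * t2 ^^ (- n2).
Proof. by apply: mulg1_eq; rewrite latM !GRing.subrr mulg1. Qed.

(** Conjugation by [c] acts on exponent vectors by the matrix with columns (p, r) and (q, s); this
    is the price of moving [c] past a lattice element. *)
Lemma lat_conj c p q r s n1 n2 :
  c * t1 * c^-1 = t1 ^^ p * t2 ^^ r -> c * t2 * c^-1 = t1 ^^ q * t2 ^^ s ->
  c * (t1 ^^ n1 * t2 ^^ n2) =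
  t1 ^^ (p * n1 + q * n2) * t2 ^^ (r * n1 + s * n2) * c.
Proof.
have conjX (x : G) n : (c * x * c^-1) ^^ n = c * x ^^ n * c^-1.
  elim/int_ind: n => [|n IH|n IH]; first by rewrite /= mulg1 mulgV.
    by rewrite -addn1 PoszD !zexpgSr IH !mulgA mulgVK.
  rewrite -addn1 PoszD GRing.opprD !zexpgBr1 IH !invgM invgK !mulgA.
  by rewrite mulgVK.
move=> e1 e2; rewrite -latM -!latX -e1 -e2 !conjX !mulgA.
by rewrite !mulgVK.
Qed.

End Lattice.

Section Generated.
Variable G : groupType.
Implicit Types (S H : set G) (x u w : G).

Lemma generated_subgroup S : is_subgroup (generated S).
Proof.
split=> [H [[]]//|x y Sx Sy H HS|x Sx H HS].
  by case: (HS) => -[_ HM _] _; apply: HM; [apply: Sx | apply: Sy].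
by case: (HS) => -[_ _ HV] _; apply: HV; apply: Sx.
Qed.

Lemma mem_generated S x : S x -> generated S x.
Proof. by move=> Sx H [_]; apply. Qed.

Lemma generated_min S H : is_subgroup H -> S `<=` H -> generated S `<=` H.
Proof. by move=> ? ?; apply: smallest_sub. Qed.

Lemma generatedM S x y : generated S x -> generated S y -> generated S (x * y).
Proof. by case: (generated_subgroup S) => _ + _; apply. Qed.

Lemma generatedV S x : generated S x -> generated S x^-1.
Proof. by case: (generated_subgroup S) => _ _; apply. Qed.

Lemma generatedX S x n : generated S x -> generated S (x ^^ n).
Proof.
move=> Sx; have SX k : generated S (x ^+ k).
  elim: k => [|k IH]; first by case: (generated_subgroup S).
  by rewrite expgS; apply: generatedM.
by case: n => n /=; [|apply: generatedV]; apply: SX.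
Qed.

Lemma generated1E w : generated [set w] = range (zexpg w).
Proof.
apply/seteqP; split; last first.
  by move=> _ [n _ <-]; apply: generatedX; apply: mem_generated.
apply: generated_min => [|_ ->]; last by exists 1%R.
split=> [|_ _ [m _ <-] [n _ <-]|_ [n _ <-]]; first by exists 0%R.
  by exists (m + n)%R => //; rewrite zexpgDr.
by exists (- n)%R => //; rewrite zexpgN.
Qed.

Lemma generated2E (t1 t2 : G) : commute t1 t2 ->
  generated [set t1; t2] = [set t1 ^^ n.1 * t2 ^^ n.2 | n in [set: int * int]].
Proof.
move=> t12; apply/seteqP; split; last first.
  move=> _ [n _ <-]; apply: generatedM; apply: generatedX; apply: mem_generated.
    by left.
  by right.
apply: generated_min => [|_ [] ->]; last first.
- by exists (0%R, 1%R) => //=; rewrite mul1g.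
- by exists (1%R, 0%R) => //=; rewrite mulg1.
split=> [|_ _ [m _ <-] [n _ <-]|_ [n _ <-]].
- by exists (0%R, 0%R) => //=; rewrite mulg1.
- by exists (m.1 + n.1, m.2 + n.2)%R => //=; rewrite latM.
- by exists (- n.1, - n.2)%R => //=; rewrite latV.
Qed.

Lemma centralizer_subgroup u : is_subgroup (centralizer u).
Proof.
rewrite /centralizer; split=> [|x y ux uy|x ux] /=.
- exact/commute_sym/commute1.
- by apply/commute_sym/commuteM; apply/commute_sym.
- exact/commute_sym/commuteV/commute_sym.
Qed.

End Generated.

(** Every class is the value of a term at the generators, so induction on a representing term
    applies. *)
Lemma presented_gen (X : Type) (R : set (gterm X * gterm X))
    (S : set (presented R)) :
  is_subgroup S -> (forall x, S (pgen R x)) -> forall g, S g.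
Proof.
move=> [S1 SM SV] SX g; rewrite -[g]pres_class_repr -gterm_eval_pgen.
by elim: (repr g) => //= [s Ss t St|s Ss]; [apply: SM | apply: SV].
Qed.

(** * Existence of normal forms *)

Section NormalForm.
Variables (G : groupType) (t1 t2 : G) (s : seq G).
Hypothesis t12 : commute t1 t2.

Definition normal_form : set G :=
  [set g | exists n1 n2 (x : G), x \in s /\ g = t1 ^^ n1 * t2 ^^ n2 * x].

(** Left multiplications allow a check on generators alone, without multiplying two normal forms. *)
Definition stable (x : G) : Prop :=
  forall g, normal_form g -> normal_form (x * g).

Lemma stableM x y : stable x -> stable y -> stable (x * y).
Proof. by move=> Sx Sy g Ng; rewrite -mulgA; apply/Sx/Sy. Qed.

Lemma stable_lat n1 n2 : stable (t1 ^^ n1 * t2 ^^ n2).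
Proof.
move=> _ [m1] [m2] [x] [sx ->].
by exists (n1 + m1)%R, (n2 + m2)%R, x; split=> //; rewrite mulgA latM.
Qed.

Lemma stable_t1 n : stable (t1 ^^ n).
Proof. by have := @stable_lat n 0%R; rewrite mulg1. Qed.

Lemma stable_t2 n : stable (t2 ^^ n).
Proof. by have := @stable_lat 0%R n; rewrite mul1g. Qed.

Lemma stableX x n : stable x -> stable (x ^+ n).
Proof.
move=> Sx; elim: n => [|n IH]; first by move=> g; rewrite mul1g.
by rewrite expgS; apply: stableM.
Qed.

(** The matrix of [c] carries the lattice part across [c]; only the products of [c] with the
    representatives remain. *)
Lemma stable_conj c p q r d :
  c * t1 * c^-1 = t1 ^^ p * t2 ^^ r -> c * t2 * c^-1 = t1 ^^ q * t2 ^^ d ->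
  (forall x, x \in s -> normal_form (c * x)) -> stable c.
Proof.
move=> e1 e2 cs _ [n1] [n2] [x] [sx ->].
rewrite mulgA (lat_conj t12 n1 n2 e1 e2) -mulgA.
exact/stable_lat/cs.
Qed.

(** The elements [g] with both [g] and [g^-1] stable form a subgroup, whereas stability alone gives
    only a monoid. A stable [g] applied to the normal form 1 yields [g]. The size is constrained
    separately because an empty list also has 1, the default value, at index 0. *)
Lemma normal_formT (S : set G) : s`_0 = 1 -> (0 < size s)%N ->
  (forall H : set G, is_subgroup H -> S `<=` H -> forall g, H g) ->
  (forall x, S x -> stable x /\ stable x^-1) -> forall g, normal_form g.
Proof.
move=> s0 ss SG Sstab g.
suff [+ _] : stable g /\ stable g^-1.
  move=> /(_ 1); rewrite mulg1; apply.
  by exists 0%R, 0%R, 1; split; [rewrite -s0 mem_nth | rewrite !mul1g].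
move: g; apply: SG => //; split=> [|x y [Sx Sx'] [Sy Sy']|x []].
- by rewrite invg1; split=> g; rewrite mul1g.
- by rewrite invgM; split; apply: stableM.
- by rewrite invgK.
Qed.

End NormalForm.

(** * Integral affine maps of the plane *)

(* (x, y, p, q, r, s) encodes the map v |-> (x, y) + [[p, q], [r, s]] v. *)
Notation affine := (int * int * int * int * int * int)%type.

Definition linear_part (a : affine) : int * int * int * int :=
  let: (_, _, p, q, r, s) := a in (p, q, r, s).

Definition affine_det (a : affine) : int :=
  let: (_, _, p, q, r, s) := a in (p * s - q * r)%R.

Definition affine_mul (a b : affine) : affine :=
  let: (x, y, p, q, r, s) := a in let: (x', y', p', q', r', s') := b in
  (x + (p * x' + q * y'), y + (r * x' + s * y'),
   p * p' + q * r', p * q' + q * s', r * p' + s * r', r * q' + s * s')%R.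

(** When d^2 = 1 the inverse matrix is [d] times the adjugate, so no division occurs. *)
Definition affine_inv (a : affine) : affine :=
  let d := affine_det a in let: (x, y, p, q, r, s) := a in
  (- (d * s * x - d * q * y), - (d * p * y - d * r * x),
   d * s, - (d * q), - (d * r), d * p)%R.

Definition translation (x y : int) : affine := (x, y, 1, 0, 0, 1)%R.

Lemma affine_eqP x y p q r s x' y' p' q' r' s' :
  (x, y, p, q, r, s) = (x', y', p', q', r', s') :> affine <->
  [/\ x = x', y = y' & [/\ p = p', q = q', r = r' & s = s']].
Proof. by split=> [[-> -> -> -> -> ->]|[-> -> [-> -> -> ->]]]. Qed.

(** The determinant is 1 or -1, expressed as a polynomial identity that can be combined with
    [ring]. *)
Definition unimodular (a : affine) : bool := (affine_det a ^+ 2 == 1)%R.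

Record aff := Aff { aff_val : affine; _ : unimodular aff_val }.
HB.instance Definition _ := [isSub for aff_val].
HB.instance Definition _ := [Choice of aff by <:].

Lemma affine_det_mul a b :
  affine_det (affine_mul a b) = (affine_det a * affine_det b)%R.
Proof.
case: a => -[[[[x y] p] q] r] s; case: b => -[[[[x' y'] p'] q'] r'] s' /=.
by ring.
Qed.

Fact aff_mul_subproof (a b : aff) :
  unimodular (affine_mul (aff_val a) (aff_val b)).
Proof.
case: a b => a /eqP da [b /eqP db] /=.
by rewrite /unimodular affine_det_mul GRing.exprMn da db.
Qed.

Fact aff_inv_subproof (a : aff) : unimodular (affine_inv (aff_val a)).
Proof.
case: a => -[[[[[x y] p] q] r] s] /eqP /=; rewrite /unimodular /=.
set d := (p * s - q * r)%R => d2; apply/eqP.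
have -> : (d * s * (d * p) - - (d * q) * - (d * r) = d ^+ 2 * d)%R.
  by rewrite /d; ring.
by rewrite d2 GRing.mul1r.
Qed.

Definition aff_one : aff := @Aff (translation 0 0) isT.
Definition aff_mul (a b : aff) : aff := Aff (aff_mul_subproof a b).
Definition aff_inv (a : aff) : aff := Aff (aff_inv_subproof a).

Fact aff_mulA : associative aff_mul.
Proof.
move=> [[[[[[x y] p] q] r] s] ?] [[[[[[x' y'] p'] q'] r'] s'] ?].
move=> [[[[[[x'' y''] p''] q''] r''] s''] ?]; apply: val_inj => /=.
by apply/affine_eqP; split; last split; ring.
Qed.

Fact aff_1mul : left_id aff_one aff_mul.
Proof.
move=> [[[[[[x y] p] q] r] s] ?]; apply: val_inj => /=.
by apply/affine_eqP; split; last split; ring.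
Qed.

Fact aff_mul1 : right_id aff_one aff_mul.
Proof.
move=> [[[[[[x y] p] q] r] s] ?]; apply: val_inj => /=.
by apply/affine_eqP; split; last split; ring.
Qed.

Fact aff_mulV : left_inverse aff_one aff_inv aff_mul.
Proof.
move=> [[[[[[x y] p] q] r] s] i]; apply: val_inj => /=.
have /eqP /= d2 := i.
by apply/affine_eqP; split; last split; rewrite -?d2; ring.
Qed.

Fact aff_Vmul : right_inverse aff_one aff_inv aff_mul.
Proof.
move=> [[[[[[x y] p] q] r] s] i]; apply: val_inj => /=.
have /eqP /= d2 := i.
apply/affine_eqP; split; last by split; rewrite -?d2; ring.
  (* The first coordinate of the composite is x - d^2 x, so the leading [x] is rewritten as d^2
     x. *)
  by rewrite -{1}[x]GRing.mul1r -d2; ring.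
by rewrite -{1}[y]GRing.mul1r -d2; ring.
Qed.

HB.instance Definition _ := isGroup.Build aff
  aff_mulA aff_1mul aff_mul1 aff_mulV aff_Vmul.

Definition aff_trans (x y : int) : aff := @Aff (translation x y) isT.

Lemma aff_transX x y n : aff_trans x y ^^ n = aff_trans (x * n) (y * n).
Proof.
elim/int_ind: n => [|n IH|n IH].
- by apply: val_inj; rewrite /= !GRing.mulr0.
- rewrite -addn1 PoszD zexpgSr IH; apply: val_inj => /=.
  by apply/affine_eqP; split; last split; ring.
- rewrite -addn1 PoszD GRing.opprD zexpgBr1 IH; apply: val_inj => /=.
  by apply/affine_eqP; split; last split; ring.
Qed.

(** * Groups represented by affine maps *)

Lemma uniq_map_inj (T U : eqType) (f : T -> U) (s : seq T) :
  uniq (map f s) -> {in s &, injective f}.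
Proof.
move=> u x y sx sy e.
rewrite -(nth_index x sx) -(nth_index x sy); congr nth; apply/eqP.
rewrite -(nth_uniq (f x) _ _ u) ?size_map ?index_mem //.
by rewrite !(nth_map x) ?index_mem // !nth_index // e.
Qed.

Lemma linear_part_translation_mul x y a :
  linear_part (affine_mul (translation x y) a) = linear_part a.
Proof.
case: a => [[[[[? ?] ?] ?] ?] ?] /=.
by rewrite !GRing.mul1r !GRing.mul0r !GRing.addr0 !GRing.add0r.
Qed.

(** The data from which normal forms and centralizers are computed. The values of [rep] are bare
    tuples, so that an equation between them splits into equations of integers. *)
Record crystallographic (G : groupType) (t1 t2 : G) (s : seq G)
    (rep : G -> affine) : Prop := Crystallographic {
  cr_comm : commute t1 t2;
  cr_repM : forall x y, rep (x * y) = affine_mul (rep x) (rep y);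
  cr_inj : injective rep;
  cr_lat : forall n1 n2,
    rep (t1 ^^ n1 * t2 ^^ n2) = translation (n1 *+ 2) (n2 *+ 2);
  cr_nf : forall g, normal_form t1 t2 s g;
  cr_uniq : uniq [seq linear_part (rep x) | x <- s]
}.

Section Crystallographic.
Variables (G : groupType) (t1 t2 : G) (s : seq G) (phi : G -> aff).
Hypothesis t12 : commute t1 t2.
Hypothesis phiM : {morph phi : x y / x * y}.
Hypothesis phi1 : phi t1 = aff_trans 2 0.
Hypothesis phi2 : phi t2 = aff_trans 0 2.
Hypothesis nf : forall g, normal_form t1 t2 s g.
Hypothesis s0 : s`_0 = 1.
Hypothesis uniq_s : uniq [seq linear_part (aff_val (phi x)) | x <- s].

Let latE n1 n2 : phi (t1 ^^ n1 * t2 ^^ n2) = aff_trans (n1 *+ 2) (n2 *+ 2).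
Proof.
rewrite phiM !(morph_zexpg phiM) phi1 phi2 !aff_transX; apply: val_inj => /=.
by apply/affine_eqP; split; last split; ring.
Qed.

(** Faithfulness is the point: an element of the kernel has trivial linear part, so its
    representative is 1, and then its translation vector (2 n1, 2 n2) vanishes. *)
Lemma crystallographicP : crystallographic t1 t2 s (aff_val \o phi).
Proof.
split=> // [x y|x y|n1 n2]; rewrite /= ?latE ?phiM //.
move/val_inj; move: x y; apply: (morph_injective phiM) => g.
have [n1 [n2 [x [sx ->]]]] := nf g => e.
(* The membership of [x] rules out the empty list, where the entry of index 0 would be the default
   value. *)
have s1 : 1 \in s.
  by rewrite -s0 mem_nth //; case: (s) sx.
have x1 : x = 1.
  apply: (uniq_map_inj uniq_s) => //=.
  move: (congr1 (linear_part \o aff_val) e) => /=.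
  by rewrite phiM latE /= linear_part_translation_mul morph_one // => ->.
move: e; rewrite x1 mulg1 latE => /(congr1 aff_val)/affine_eqP[e1 e2 _].
have -> : n1 = 0%R by lia.
have -> : n2 = 0%R by lia.
by rewrite mulg1.
Qed.

End Crystallographic.

(** * The lattice, its index, and uniqueness of normal forms *)

Section Consequences.
Variables (G : groupType) (t1 t2 : G) (s : seq G) (rep : G -> affine).
Hypothesis cr : crystallographic t1 t2 s rep.
Let t12 := cr_comm cr.
Let H := generated [set t1; t2].

Lemma cr_lat_inj n1 n2 m1 m2 :
  t1 ^^ n1 * t2 ^^ n2 = t1 ^^ m1 * t2 ^^ m2 -> n1 = m1 /\ n2 = m2.
Proof.
move=> /(congr1 rep); rewrite !(cr_lat cr) => /affine_eqP[e1 e2 _].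
by split; lia.
Qed.

Lemma cr_lat_eq1 n1 n2 : t1 ^^ n1 * t2 ^^ n2 = 1 -> n1 = 0%R /\ n2 = 0%R.
Proof. by move=> e; apply: cr_lat_inj; rewrite e mulg1. Qed.

Lemma linear_part_lat n1 n2 x :
  linear_part (rep (t1 ^^ n1 * t2 ^^ n2 * x)) = linear_part (rep x).
Proof.
by rewrite (cr_repM cr) (cr_lat cr) linear_part_translation_mul.
Qed.

Lemma cr_ZxZ : isomorphic_to ZxZ H.
Proof.
pose f (n : ZxZ) : G := t1 ^^ n.1 * t2 ^^ n.2.
have fM : {morph f : x y / x * y} by move=> x y; rewrite /f latM.
pose fm := isMultiplicative.Build _ _ f fM.
exists (HB.pack_for {multiplicative ZxZ -> G} f fm); split.
  by move=> [n1 n2] [m1 m2] /= /cr_lat_inj /= [-> ->].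
by rewrite /H generated2E.
Qed.

Lemma cr_free_abelian : free_abelian_of_rank 2 H.
Proof.
pose V := Algebra.to_multiplicative 'rV[int]_2.
pose f (n : V) : G :=
  t1 ^^ (n : 'rV[int]_2) ord0 ord0 * t2 ^^ (n : 'rV[int]_2) ord0 ord_max.
have fM : {morph f : x y / x * y}.
  move=> x y; rewrite /f latM //.
  by congr (t1 ^^ _ * t2 ^^ _); apply: mxE.
pose fm := isMultiplicative.Build _ _ f fM.
exists (HB.pack_for {multiplicative V -> G} f fm); split.
  move=> n m /cr_lat_inj /= [e0 e1]; apply/rowP => i.
  have [->|->] : i = ord0 \/ i = ord_max.
    by case: i => -[|[|//]] ?; [left | right]; apply: val_inj.
    exact: e0.
  exact: e1.
rewrite /H generated2E //; apply/seteqP; split=> _ [n _ <-].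
  by exists (((n : 'rV[int]_2) ord0 ord0), (n : 'rV[int]_2) ord0 ord_max).
exists ((\row_i if i == ord0 then n.1 else n.2)%R : V) => //.
by rewrite /= /f !mxE.
Qed.

Lemma cr_finite_index : finite_index H.
Proof.
apply: (@sub_finite_set _ _
  [set [set x^-1 * h | h in H] | x in [set` s]]); last first.
  exact/finite_image/finite_seq.
move=> _ [g _ <-].
(* Cosets are of the form [g H], but normal forms carry the representative on the right; the normal
   form of [g^-1] gives g H = x^-1 H. *)
have [n1 [n2 [x [sx e]]]] := cr_nf cr g^-1.
exists x => //.
have [_ HM HV] := generated_subgroup [set t1; t2].
have HT : H (t1 ^^ n1 * t2 ^^ n2) by rewrite /H generated2E //; exists (n1, n2).
have -> : g = x^-1 * (t1 ^^ n1 * t2 ^^ n2)^-1 by rewrite -invgM -e invgK.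
apply/seteqP; split=> _ [h Hh <-].
  exists (t1 ^^ n1 * t2 ^^ n2 * h); first exact: HM.
  by rewrite -mulgA mulKg.
exists ((t1 ^^ n1 * t2 ^^ n2)^-1 * h); last by rewrite mulgA.
by apply: HM => //; apply: HV.
Qed.

(** The linear part determines the position in [s]; once the representative is cancelled, the
    translation determines the exponents. *)
Lemma cr_unique_form : unique_form t1 t2 s.
Proof.
move=> g; have [n1 [n2 [x [sx ->]]]] := cr_nf cr g.
pose k : 'I_(size s) := Ordinal (etrans (index_mem x s) sx).
have xk : s`_k = x by rewrite nth_index.
exists (n1, n2, k); split; first by rewrite /= nth_index.
move=> [[m1 m2] l]; rewrite /= -xk => e.
have kl : k = l.
  have := cr_uniq cr; move/uniq_map_inj/(_ _ _ (mem_nth _ (ltn_ord k)))=> kl.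
  apply/val_inj/eqP; rewrite -(nth_uniq 1 (ltn_ord k) (ltn_ord l)); last first.
    exact: map_uniq (cr_uniq cr).
  apply/eqP/kl; first exact/mem_nth/ltn_ord.
  move: (congr1 (linear_part \o rep) e).
  by rewrite /= !linear_part_lat.
by move: e; rewrite -kl => /mulIg/cr_lat_inj[-> ->].
Qed.

Lemma cr_generators :
  [/\ free_abelian_of_rank 2 H /\ finite_index H, isomorphic_to ZxZ H &
      unique_form t1 t2 s].
Proof.
split; [split; [exact: cr_free_abelian | exact: cr_finite_index] | |].
- exact: cr_ZxZ.
- exact: cr_unique_form.
Qed.

End Consequences.

(** * Centralizers computed through the representation *)

Section Representation.
Variables (G : groupType) (t1 t2 : G) (s : seq G) (rep : G -> affine).
Hypothesis cr : crystallographic t1 t2 s rep.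

Lemma rep_one : rep 1 = translation 0 0.
Proof.
have <- : t1 ^^ 0 * t2 ^^ 0 = 1 by rewrite mulg1.
exact: cr_lat cr 0%R 0%R.
Qed.

Lemma rep_latM n1 n2 x : rep (t1 ^^ n1 * t2 ^^ n2 * x) =
  affine_mul (translation (n1 *+ 2) (n2 *+ 2)) (rep x).
Proof. by rewrite (cr_repM cr) (cr_lat cr). Qed.

(** Powers are taken on tuples, outside the group [aff], so that those of a concrete rotation
    evaluate to numerals. *)
Definition affine_expn (a : affine) n : affine :=
  iter n (affine_mul a) (translation 0 0).

Lemma rep_expg x n : rep (x ^+ n) = affine_expn (rep x) n.
Proof.
elim: n => [|n IH]; first exact: rep_one.
by rewrite expgS (cr_repM cr) IH.
Qed.

(** Faithfulness of [rep] turns commutation into linear equations. *)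
Lemma commute_repP x y :
  commute x y <-> affine_mul (rep x) (rep y) = affine_mul (rep y) (rep x).
Proof.
rewrite -!(cr_repM cr); split=> [->//|]; exact: (cr_inj cr).
Qed.

(** Since the centralizer is a subgroup, one inclusion is checked on generators; the other is
    checked on normal forms. *)
Lemma centralizer_generated u S : (forall x, S x -> commute x u) ->
  (forall n1 n2 x, x \in s -> commute (t1 ^^ n1 * t2 ^^ n2 * x) u ->
    generated S (t1 ^^ n1 * t2 ^^ n2 * x)) ->
  centralizer u = generated S.
Proof.
move=> Su uS; apply/seteqP; split=> g.
  by have [n1 [n2 [x [sx ->]]]] := cr_nf cr g; apply: uS.
exact: generated_min (centralizer_subgroup u) Su g.
Qed.

(** Lattice elements commute with each other, so whether a normal form centralizes a lattice element
    depends only on its representative. *)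
Lemma centralizer_lat n1 n2 :
  (forall x, x \in s -> commute x (t1 ^^ n1 * t2 ^^ n2) -> x = 1) ->
  centralizer (t1 ^^ n1 * t2 ^^ n2) = generated [set t1; t2].
Proof.
have t12 := cr_comm cr.
have latC m1 m2 : commute (t1 ^^ m1 * t2 ^^ m2) (t1 ^^ n1 * t2 ^^ n2).
  by rewrite /commute !latM // GRing.addrC [(m2 + _)%R]GRing.addrC.
move=> s1; apply: centralizer_generated => [_ [] ->|m1 m2 x sx mx].
- by have := latC 1%R 0%R; rewrite mulg1.
- by have := latC 0%R 1%R; rewrite mul1g.
rewrite generated2E //; exists (m1, m2) => //=.
rewrite (s1 x) ?mulg1 // -[x](mulKg (t1 ^^ m1 * t2 ^^ m2)).
by apply/commute_sym/commuteM; [apply/commuteV|]; apply/commute_sym.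
Qed.

Lemma lat_neq1 n1 n2 : t1 ^^ n1 * t2 ^^ n2 <> 1 -> ~ (n1 = 0%R /\ n2 = 0%R).
Proof. by move=> + [n10 n20]; rewrite n10 n20 mulg1. Qed.

End Representation.

(** * Groups whose point group is cyclic *)

Definition cyclic_gens (C : aff) (x : gens_c) : aff :=
  match x with
  | c_c => C | c_t1 => aff_trans 2 0 | c_t2 => aff_trans 0 2
  end.

Lemma commutator_eq1 (G : groupType) (x y : G) :
  commutator x y = 1 -> commute x y.
Proof. by move=> /divg1_eq /(congr1 (fun z => z * x)); rewrite /= mulgVK. Qed.

Section CyclicPointGroup.
Variables (R : set (gterm gens_c * gterm gens_c)) (C : aff) (m : nat).
Let c : presented R := pgen R c_c.
Let t1 : presented R := pgen R c_t1.
Let t2 : presented R := pgen R c_t2.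

(** Here [c] has order [m.+1], and its powers serve as representatives. Multiplication by [c]
    permutes them cyclically, and c^-1 = c^m reduces the stability of the inverse to that of [c]. *)
Lemma cyclic_crystallographic p q r s :
  (forall x, R x ->
    gterm_eval (cyclic_gens C) x.1 = gterm_eval (cyclic_gens C) x.2) ->
  c ^+ m.+1 = 1 -> commutator t1 t2 = 1 ->
  c * t1 * c^-1 = t1 ^^ p * t2 ^^ r -> c * t2 * c^-1 = t1 ^^ q * t2 ^^ s ->
  uniq [seq linear_part (aff_val (C ^+ k)) | k <- iota 0 m.+1] ->
  exists2 rep, crystallographic t1 t2 (mkseq (natexp c) m.+1) rep
             & rep c = aff_val C.
Proof.
move=> /presented_lift[phi phiE] cm /commutator_eq1 t12 e1 e2 uniqC.
have phiM : {morph phi : x y / x * y} by apply: gmulfM.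
exists (aff_val \o phi); last by rewrite /= phiE.
apply: (crystallographicP t12 phiM) => //; rewrite ?phiE //; last first.
  rewrite -map_comp; apply: etrans uniqC; congr uniq.
  by apply: eq_map => k /=; rewrite (morph_expg phiM) phiE.
have stc : stable t1 t2 (mkseq (natexp c) m.+1) c.
  apply: (stable_conj t12 e1 e2) => x /mapP[k]; rewrite mem_iota add0n /=.
  move=> km ->; exists 0%R, 0%R, (c ^+ (k.+1 %% m.+1)); split.
    by apply: map_f; rewrite mem_iota ltn_mod.
  rewrite !mul1g -expgS; move: km; rewrite leq_eqVlt.
  case/orP => [/eqP[->]|km]; first by rewrite modnn.
  by rewrite modn_small.
apply: (normal_formT (S := [set c; t1; t2])) => //.
  by move=> H HH SH; apply: presented_gen => // -[]; apply: SH;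
    [left; left | left; right | right].
have cV : c^-1 = c ^+ m by apply: mulg1_eq; rewrite -expgS.
move=> _ [[]|] -> .
- by split=> //; rewrite cV; apply: stableX.
- by split; [apply: (stable_t1 t12 1) | apply: (stable_t1 t12 (-1))].
- by split; [apply: (stable_t2 t12 1) | apply: (stable_t2 t12 (-1))].
Qed.

End CyclicPointGroup.

Lemma linear_part_congr a a' b b' :
  linear_part a = linear_part a' -> linear_part b = linear_part b' ->
  linear_part (affine_mul a b) = linear_part (affine_mul a' b').
Proof.
case: a => [[[[[? ?] ?] ?] ?] ?]; case: a' => [[[[[? ?] ?] ?] ?] ?].
case: b => [[[[[? ?] ?] ?] ?] ?]; case: b' => [[[[[? ?] ?] ?] ?] ?].
by move=> /= [-> -> -> ->] [-> -> -> ->].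
Qed.

Section CentralizerCycle.
Variables (G : groupType) (t1 t2 : G) (s : seq G) (rep : G -> affine).
Hypothesis cr : crystallographic t1 t2 s rep.

Lemma linear_part_expg x y n :
  linear_part (rep x) = linear_part (rep y) ->
  linear_part (rep (x ^+ n)) = linear_part (rep (y ^+ n)).
Proof.
move=> xy; elim: n => [//|n IH].
by rewrite !expgS !(cr_repM cr); apply: linear_part_congr.
Qed.

(** Representatives are separated by their linear parts, so [g] and [h] share theirs and differ by a
    lattice element. *)
Lemma linear_part_inj g h : linear_part (rep g) = linear_part (rep h) ->
  exists n1 n2, g = t1 ^^ n1 * t2 ^^ n2 * h.
Proof.
have [n1 [n2 [x [sx ->]]]] := cr_nf cr g.
have [m1 [m2 [y [sy ->]]]] := cr_nf cr h.
rewrite !(linear_part_lat cr) => /(uniq_map_inj (cr_uniq cr) sx sy) ->.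
exists (n1 - m1)%R, (n2 - m2)%R.
by rewrite mulgA latM ?GRing.subrK //; exact: cr_comm cr.
Qed.

(* If g has the linear part of a power w^i, then g w^-i is a translation, and
   it centralizes u because w does. *)
Lemma centralizer_cycle u w : commute w u ->
  (forall n1 n2, commute (t1 ^^ n1 * t2 ^^ n2) u ->
    generated [set w] (t1 ^^ n1 * t2 ^^ n2)) ->
  (forall n1 n2 x, x \in s -> commute (t1 ^^ n1 * t2 ^^ n2 * x) u ->
    exists i, linear_part (rep x) = linear_part (rep (w ^+ i))) ->
  centralizer u = generated [set w].
Proof.
move=> wu tu xu; apply: (centralizer_generated cr) => [_ ->//|n1 n2 x sx gu].
have [i] := xu _ _ _ sx gu.
rewrite -(linear_part_lat cr n1 n2 x) => /linear_part_inj[m1 [m2 e]].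
have wi : generated [set w] (w ^+ i).
  exact: (generatedX (Posz i) (mem_generated erefl)).
rewrite e; apply: generatedM => //; apply: tu.
have -> : t1 ^^ m1 * t2 ^^ m2 = t1 ^^ n1 * t2 ^^ n2 * x * (w ^+ i)^-1.
  by rewrite e mulgK.
apply/commute_sym/commuteM; first exact/commute_sym.
by apply/commuteV/commuteX/commute_sym.
Qed.

End CentralizerCycle.

Section CyclicCentralizers.
Variables (G : groupType) (t1 t2 c : G) (m : nat) (rep : G -> affine) (C : aff).
Hypothesis cr : crystallographic t1 t2 (mkseq (natexp c) m) rep.
Hypothesis rep_c : rep c = aff_val C.

(** The value of [rep] at t1^n1 t2^n2 x when [a] is its value at [x]. *)
Definition lattice_mul n1 n2 (a : affine) : affine :=
  affine_mul (translation (n1 *+ 2) (n2 *+ 2)) a.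

(** The hypothesis expresses, as equations, that a nontrivial rotation fixes no nonzero vector. *)
Lemma cyclic_centralizer_lat u n1 n2 :
  u <> 1 -> u = t1 ^^ n1 * t2 ^^ n2 ->
  (forall k, (0 < k < m)%N ->
    affine_mul (affine_expn (aff_val C) k) (translation (n1 *+ 2) (n2 *+ 2)) =
    affine_mul (translation (n1 *+ 2) (n2 *+ 2)) (affine_expn (aff_val C) k) ->
    n1 = 0%R /\ n2 = 0%R) ->
  centralizer u = generated [set t1; t2].
Proof.
move=> /[swap] -> /lat_neq1 n0 H; apply: (centralizer_lat cr) => x /mapP[[|k]].
  by move=> _ ->.
rewrite mem_iota /= add0n => km -> /(commute_repP cr).
by rewrite (rep_expg cr) (cr_lat cr) rep_c => /H -/(_ km).
Qed.

(** The hypotheses say that [w] commutes with [u], that no nonzero translation does, and that no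
    element over c^k does unless [d] divides [k]. If k = i d, then w^i has the linear part of c^k,
    as [centralizer_cycle] requires. *)
Lemma cyclic_centralizer_cycle u w j d n1 n2 a b :
  u = t1 ^^ n1 * t2 ^^ n2 * c ^+ j -> w = t1 ^^ a * t2 ^^ b * c ^+ d ->
  let u' := lattice_mul n1 n2 (affine_expn (aff_val C) j) in
  let w' := lattice_mul a b (affine_expn (aff_val C) d) in
  affine_mul w' u' = affine_mul u' w' ->
  (forall p q, affine_mul (translation (p *+ 2) (q *+ 2)) u' =
     affine_mul u' (translation (p *+ 2) (q *+ 2)) -> p = 0%R /\ q = 0%R) ->
  (forall k p q, (k < m)%N -> ~~ (d %| k) ->
    let g' := lattice_mul p q (affine_expn (aff_val C) k) in
    affine_mul g' u' <> affine_mul u' g') ->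
  centralizer u = generated [set w].
Proof.
have repE p q k : rep (t1 ^^ p * t2 ^^ q * c ^+ k) =
    lattice_mul p q (affine_expn (aff_val C) k).
  by rewrite (rep_latM cr) (rep_expg cr) rep_c.
move=> eu ew u' w' wu tu xu; apply: (centralizer_cycle cr).
- by apply/(commute_repP cr); rewrite eu ew !repE.
- move=> p q /(commute_repP cr); rewrite eu repE (cr_lat cr) => /tu[-> ->].
  by rewrite mulg1; case: (generated_subgroup [set w]).
- move=> p q x /mapP[k]; rewrite mem_iota add0n /= => km -> /(commute_repP cr).
  rewrite eu !repE; have [/dvdnP[i ->] _|nd] := boolP (d %| k); last first.
    by move/(xu k p q km nd).
  exists i; rewrite mulnC expgnA; apply: (linear_part_expg cr).
  by rewrite ew (linear_part_lat cr).
Qed.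

End CyclicCentralizers.

(* Powers of a closed affine map are evaluated beforehand: unfolding them along
   with the symbolic part of the goal duplicates subterms exponentially. *)
Ltac eval_affine_powers :=
  repeat match goal with
  | |- context [affine_expn ?A ?k] =>
    let v := eval vm_compute in (affine_expn A k) in
    change (affine_expn A k) with v
  end.

(** The first branch proves an equation of affine maps, the second exploits one. A commutation
    hypothesis carries information only in its two translation coordinates, as all six point groups
    are abelian. *)
Ltac equations_tac :=
  cbv [lattice_mul affine_mul translation];
  first
  [ apply/affine_eqP; split; [lia | lia | split; lia]
  | let e1 := fresh in let e2 := fresh in
    move=> /affine_eqP[e1 e2 _]; try split; lia ].

Ltac lat_tac :=
  let k := fresh "k" in
  move=> k; repeat (case: k => [|k] //); move=> _;
  eval_affine_powers; equations_tac.

Ltac cycle_tac :=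
  [> eval_affine_powers; equations_tac
   | move=> ? ?; eval_affine_powers; equations_tac
   | let k := fresh "k" in
     move=> k ? ?; repeat (case: k => [|k] //); move=> _ _;
     eval_affine_powers; equations_tac ].

(** An explicit set of relations is a union nested to the left. *)
Ltac relation_tac :=
  first [ reflexivity | right; reflexivity | left; relation_tac ].

(** * Glides and the Klein bottle group *)

Section Glide.
Variables (G : groupType) (a t : G).
Hypothesis at_ : a * t * a^-1 = t^-1.

(** Conjugation by [a] inverts [t], and inverting twice is the identity. *)
Lemma glide_sqr_commute : commute (a ^+ 2) t.
Proof.
have ata : a * t = t^-1 * a by rewrite -at_ mulgVK.
have atV : a * t^-1 = t * a.
  by apply: (@mulgI _ t^-1); rewrite mulKg mulgA -ata mulgK.
by rewrite /commute expg2 -mulgA ata mulgA atV mulgA.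
Qed.

Lemma glide_stable : stable (a ^+ 2) t [:: 1; a] a.
Proof.
apply: (stable_conj glide_sqr_commute (p := 1) (q := 0) (r := 0) (d := -1)).
- by rewrite mulg1 expg2 mulgA mulgK.
- by rewrite mul1g at_.
move=> x; rewrite !inE => /orP[/eqP|/eqP] ->.
  by exists 0%R, 0%R, a; rewrite !inE eqxx orbT !mul1g mulg1.
by exists 1%R, 0%R, 1; rewrite !inE eqxx !mulg1.
Qed.

Lemma glide_stableV : stable (a ^+ 2) t [:: 1; a] a^-1.
Proof.
have -> : a^-1 = (a ^+ 2) ^^ (-1) * a by rewrite /= expg2 invgM mulgVK.
by apply: stableM glide_stable; apply: stable_t1; exact: glide_sqr_commute.
Qed.

End Glide.

(** The substitution x = t a, y = a^-1 matches x^2 y^2 = 1 with the glide relation. Normal forms in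
    the Klein bottle group reduce injectivity to the last two hypotheses, which keep nontrivial
    normal forms out of the kernel. *)
Lemma isomorphic_to_klein (G : groupType) (a t : G) :
  a * t * a^-1 = t^-1 ->
  (forall n1 n2, (a ^+ 2) ^^ n1 * t ^^ n2 = 1 -> n1 = 0%R /\ n2 = 0%R) ->
  (forall n1 n2, (a ^+ 2) ^^ n1 * t ^^ n2 * a <> 1) ->
  isomorphic_to klein_group (generated [set a; t]).
Proof.
move=> at_ lat1 glideN1.
pose f v := match v with xy_x => t * a | xy_y => a^-1 end.
have [|phi phiE] := @presented_lift _ klein_rels G f.
  move=> _ -> /=.
  suff : t * a * (t * a) * (a^-1 * a^-1) = 1 by [].
  have -> : t * a * (t * a) * (a^-1 * a^-1) = t * (a * t * a^-1).
    by rewrite !mulgA mulgK.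
  by rewrite at_ mulgV.
have phiM : {morph phi : x y / x * y} by apply: gmulfM.
exists phi; pose x := pgen klein_rels xy_x; pose y := pgen klein_rels xy_y.
have px : phi x = t * a := phiE xy_x.
have py : phi y = a^-1 := phiE xy_y.
have xy1 : x * x * (y * y) = 1.
  by apply: (@presented_rel _ klein_rels (gVar xy_x ^+ 2 * gVar xy_y ^+ 2) 1).
(* y^-1 and x y play in the Klein bottle group the roles of a and t. *)
have yxy : y^-1 * (x * y) * y^-1^-1 = (x * y)^-1.
  have xyy : x * y * y = x^-1.
    by apply/esym/mulg1_eq; rewrite !mulgA -[RHS]xy1 !mulgA.
  by rewrite invgK -mulgA xyy invgM.
have phib : phi y^-1 = a by rewrite (morph_inv phiM) py invgK.
have phit : phi (x * y) = t by rewrite phiM px py mulgK.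
split.
  apply: (morph_injective phiM) => k.
  have [] := @normal_formT _ (y^-1 ^+ 2) (x * y) [:: 1; y^-1]
      [set x; y] erefl erefl _ _ k.
  - by move=> H HH SH; apply: presented_gen => // -[]; apply: SH; [left | right].
  - have st := glide_stable yxy; have := glide_stableV yxy.
    rewrite invgK => stV.
    have tst n : stable (y^-1 ^+ 2) (x * y) [:: 1; y^-1] ((x * y) ^^ n).
      exact: stable_t2 (glide_sqr_commute yxy) n.
    move=> _ [] ->; last by split.
    split.
      (* The generator is recovered as x = (x y) y^-1, and its inverse as x^-1 = y (x y)^-1. *)
      by have := stableM (tst 1%R) st; rewrite -[_ ^^ 1]/(x * y) mulgK.
    have := stableM stV (tst (-1)%R).
    by rewrite -[_ ^^ (-1)]/((x * y)^-1) invgM mulVKg.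
  move=> n1 [n2 [z [+ ->]]]; rewrite !inE => /orP[]/eqP->;
    rewrite !phiM !(morph_zexpg phiM) (morph_expg phiM) phib phit.
    by rewrite (morph_one phiM) !mulg1 => /lat1[-> ->]; rewrite mulg1.
  by move/glideN1.
apply/seteqP; split=> [_ [k _ <-]|].
    move: k; apply: presented_gen; last first.
      have ga : generated [set a; t] a by apply: mem_generated; left.
      have gt : generated [set a; t] t by apply: mem_generated; right.
      by case; rewrite phiE; [apply: generatedM | apply: generatedV].
    split=> [|k l|k]; rewrite ?(morph_one phiM) ?phiM ?(morph_inv phiM).
    - by case: (generated_subgroup [set a; t]).
    - exact: generatedM.
    - exact: generatedV.
  apply: generated_min => [|_ [] ->].
  - split=> [|_ _ [k _ <-] [l _ <-]|_ [k _ <-]].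
    + by exists 1; rewrite // morph_one.
    + by exists (k * l).
    + by exists k^-1; rewrite // morph_inv.
  - by exists y^-1; rewrite // morph_inv // py invgK.
  - by exists (x * y); rewrite // phiM px py mulgK.
Qed.

Section LatticeLines.
Variables (G : groupType) (t1 t2 : G) (s : seq G) (rep : G -> affine).
Hypothesis cr : crystallographic t1 t2 s rep.

Lemma mem_generated_t1 n1 n2 :
  generated [set t1] (t1 ^^ n1 * t2 ^^ n2) <-> n2 = 0%R.
Proof.
rewrite generated1E; split=> [[k _]|->]; last by exists n1; rewrite // mulg1.
rewrite -[t1 ^^ k]mulg1 -[1]/(t2 ^^ 0).
by move=> /(cr_lat_inj cr)[].
Qed.

Lemma mem_generated_t2 n1 n2 :
  generated [set t2] (t1 ^^ n1 * t2 ^^ n2) <-> n1 = 0%R.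
Proof.
rewrite generated1E; split=> [[k _]|->]; last by exists n2; rewrite // mul1g.
rewrite -[t2 ^^ k]mul1g -[1]/(t1 ^^ 0).
by move=> /(cr_lat_inj cr)[].
Qed.
End LatticeLines.

(** * The six groups *)

(** The matrices are written in the lattice basis, which makes rotations of order 3 and 6 integral;
    their columns are the exponents of the conjugates of [t1] and [t2] by [c]. *)
Definition rotation2 : aff := @Aff (0, 0, -1, 0, 0, -1)%R isT.
Definition rotation3 : aff := @Aff (0, 0, 0, -1, 1, -1)%R isT.
Definition rotation4 : aff := @Aff (0, 0, 0, -1, 1, 0)%R isT.
Definition rotation6 : aff := @Aff (0, 0, 0, -1, 1, 1)%R isT.

(** Its translation is half of (2, 0), so that its square is the image of [t1]. *)
Definition glide1 : aff := @Aff (1, 0, 1, 0, 0, -1)%R isT.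
(* The axis of the glide is shifted off the origin, the center of [rotation2],
   so that c a c^-1 = t2 a^-1. *)
Definition glide6 : aff := @Aff (1, -1, 1, 0, 0, -1)%R isT.

Lemma G1_relations :
  let a := pgen rels1 a_a in let t2 := pgen rels1 a_t2 in
  a ^+ 2 = pgen rels1 a_t1 /\ a * t2 * a^-1 = t2^-1.
Proof.
have rel s t : rels1 (s, t) ->
    gterm_eval (pgen rels1) s = gterm_eval (pgen rels1) t by exact: presented_rel.
split; first by apply: (rel (gVar a_a ^+ 2) (gVar a_t1)); relation_tac.
apply: (rel (gVar a_a * gVar a_t2 * (gVar a_a)^-1) (gVar a_t2)^-1).
by relation_tac.
Qed.

Lemma G1_crystallographic :
  let a := pgen rels1 a_a in
  exists2 rep, crystallographic (pgen rels1 a_t1) (pgen rels1 a_t2) [:: 1; a] rep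
             & rep a = (1, 0, 1, 0, 0, -1)%R.
Proof.
move=> a.
pose t1 := pgen rels1 a_t1; pose t2 := pgen rels1 a_t2.
pose f v := match v with
  | a_a => glide1 | a_t1 => aff_trans 2 0 | a_t2 => aff_trans 0 2 end.
have [|phi phiE] := @presented_lift _ rels1 _ f.
  by move=> x [[->|->]|->]; apply: val_inj; vm_compute.
have phiM : {morph phi : x y / x * y} by apply: gmulfM.
have [aa at_] : a ^+ 2 = t1 /\ a * t2 * a^-1 = t2^-1 := G1_relations.
have t12 : commute t1 t2 by rewrite -aa; apply: glide_sqr_commute.
exists (aff_val \o phi); last by rewrite /= phiE.
apply: (crystallographicP t12 phiM) => //; rewrite ?phiE //; last first.
  by rewrite /= (morph_one phiM) phiE.
apply: (normal_formT (S := [set a; t1; t2])) => //.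
  by move=> H HH SH; apply: presented_gen => // -[]; apply: SH;
    [left; left | left; right | right].
move=> _ [[]|] -> .
- by rewrite -aa; split; [apply: glide_stable | apply: glide_stableV].
- by split; [apply: (stable_t1 t12 1) | apply: (stable_t1 t12 (-1))].
- by split; [apply: (stable_t2 t12 1) | apply: (stable_t2 t12 (-1))].
Qed.

Lemma G2_crystallographic :
  let c := pgen rels2 c_c in
  exists2 rep,
    crystallographic (pgen rels2 c_t1) (pgen rels2 c_t2) (mkseq (natexp c) 2) rep
  & rep c = aff_val rotation2.
Proof.
pose c' := gVar c_c; pose t1' := gVar c_t1; pose t2' := gVar c_t2.
have rel s t : rels2 (s, t) ->
    gterm_eval (pgen rels2) s = gterm_eval (pgen rels2) t by exact: presented_rel.
(* The first numeral is the order of [c] minus one; the other four are the matrix entries p, q, r,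
   s. *)
apply: (@cyclic_crystallographic _ _ 1 (-1)%R 0%R 0%R (-1)%R).
- by move=> x [[[->|->]|->]|->]; apply: val_inj; vm_compute.
- by apply: (rel (c' ^+ 2) 1); relation_tac.
- by apply: (rel (commutator t1' t2') 1); relation_tac.
- by rewrite mulg1; apply: (rel (c' * t1' * c'^-1) t1'^-1); relation_tac.
- by rewrite mul1g; apply: (rel (c' * t2' * c'^-1) t2'^-1); relation_tac.
- by vm_compute.
Qed.

Lemma G3_crystallographic :
  let c := pgen rels3 c_c in
  exists2 rep,
    crystallographic (pgen rels3 c_t1) (pgen rels3 c_t2) (mkseq (natexp c) 3) rep
  & rep c = aff_val rotation3.
Proof.
pose c' := gVar c_c; pose t1' := gVar c_t1; pose t2' := gVar c_t2.
have rel s t : rels3 (s, t) ->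
    gterm_eval (pgen rels3) s = gterm_eval (pgen rels3) t by exact: presented_rel.
apply: (@cyclic_crystallographic _ _ 2 0%R (-1)%R 1%R (-1)%R).
- by move=> x [[[->|->]|->]|->]; apply: val_inj; vm_compute.
- by apply: (rel (c' ^+ 3) 1); relation_tac.
- by apply: (rel (commutator t1' t2') 1); relation_tac.
- by rewrite mul1g; apply: (rel (c' * t1' * c'^-1) t2'); relation_tac.
- by apply: (rel (c' * t2' * c'^-1) (t1'^-1 * t2'^-1)); relation_tac.
- by vm_compute.
Qed.

Lemma G4_crystallographic :
  let c := pgen rels4 c_c in
  exists2 rep,
    crystallographic (pgen rels4 c_t1) (pgen rels4 c_t2) (mkseq (natexp c) 4) rep
  & rep c = aff_val rotation4.
Proof.
pose c' := gVar c_c; pose t1' := gVar c_t1; pose t2' := gVar c_t2.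
have rel s t : rels4 (s, t) ->
    gterm_eval (pgen rels4) s = gterm_eval (pgen rels4) t by exact: presented_rel.
apply: (@cyclic_crystallographic _ _ 3 0%R (-1)%R 1%R 0%R).
- by move=> x [[[->|->]|->]|->]; apply: val_inj; vm_compute.
- by apply: (rel (c' ^+ 4) 1); relation_tac.
- by apply: (rel (commutator t1' t2') 1); relation_tac.
- by rewrite mul1g; apply: (rel (c' * t1' * c'^-1) t2'); relation_tac.
- by rewrite mulg1; apply: (rel (c' * t2' * c'^-1) t1'^-1); relation_tac.
- by vm_compute.
Qed.

Lemma G5_crystallographic :
  let c := pgen rels5 c_c in
  exists2 rep,
    crystallographic (pgen rels5 c_t1) (pgen rels5 c_t2) (mkseq (natexp c) 6) rep
  & rep c = aff_val rotation6.
Proof.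
pose c' := gVar c_c; pose t1' := gVar c_t1; pose t2' := gVar c_t2.
have rel s t : rels5 (s, t) ->
    gterm_eval (pgen rels5) s = gterm_eval (pgen rels5) t by exact: presented_rel.
apply: (@cyclic_crystallographic _ _ 5 0%R (-1)%R 1%R 1%R).
- by move=> x [[[->|->]|->]|->]; apply: val_inj; vm_compute.
- by apply: (rel (c' ^+ 6) 1); relation_tac.
- by apply: (rel (commutator t1' t2') 1); relation_tac.
- by rewrite mul1g; apply: (rel (c' * t1' * c'^-1) t2'); relation_tac.
- by apply: (rel (c' * t2' * c'^-1) (t1'^-1 * t2')); relation_tac.
- by vm_compute.
Qed.

Lemma G6_relations :
  let a := pgen rels6 ac_a in let c := pgen rels6 ac_c in
  let t1 := pgen rels6 ac_t1 in let t2 := pgen rels6 ac_t2 in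
  [/\ a ^+ 2 = t1, c ^+ 2 = 1, a * t2 * a^-1 = t2^-1 &
   [/\ c * t1 * c^-1 = t1^-1, c * t2 * c^-1 = t2^-1 & c * a * c^-1 = t2 * a^-1]].
Proof.
move=> a c t1 t2.
pose a' := gVar ac_a; pose c' := gVar ac_c.
pose t1' := gVar ac_t1; pose t2' := gVar ac_t2.
have rel s t : rels6 (s, t) ->
    gterm_eval (pgen rels6) s = gterm_eval (pgen rels6) t.
  exact: presented_rel.
do ![split].
- by apply: (rel (a' ^+ 2) t1'); relation_tac.
- by apply: (rel (c' ^+ 2) 1); relation_tac.
- by apply: (rel (a' * t2' * a'^-1) (t2'^-1)); relation_tac.
- by apply: (rel (c' * t1' * c'^-1) (t1'^-1)); relation_tac.
- by apply: (rel (c' * t2' * c'^-1) (t2'^-1)); relation_tac.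
- by apply: (rel (c' * a' * c'^-1) (t2' * a'^-1)); relation_tac.
Qed.

Lemma G6_crystallographic :
  let a := pgen rels6 ac_a in let c := pgen rels6 ac_c in
  exists2 rep,
    crystallographic (pgen rels6 ac_t1) (pgen rels6 ac_t2) [:: 1; a; c; a * c] rep
  & rep a = (1, -1, 1, 0, 0, -1)%R /\ rep c = (0, 0, -1, 0, 0, -1)%R.
Proof.
move=> a c.
pose t1 := pgen rels6 ac_t1; pose t2 := pgen rels6 ac_t2.
pose f v := match v with
  | ac_a => glide6 | ac_c => rotation2
  | ac_t1 => aff_trans 2 0 | ac_t2 => aff_trans 0 2 end.
have [|phi phiE] := @presented_lift _ rels6 _ f.
  by move=> x [[[[[[->|->]|->]|->]|->]|->]|->]; apply: val_inj; vm_compute.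
have phiM : {morph phi : x y / x * y} by apply: gmulfM.
have [aa cc at_ [ct1 ct2 ca]] : [/\ a ^+ 2 = t1, c ^+ 2 = 1, a * t2 * a^-1 = t2^-1 &
   [/\ c * t1 * c^-1 = t1^-1, c * t2 * c^-1 = t2^-1 & c * a * c^-1 = t2 * a^-1]].
  exact: G6_relations.
have t12 : commute t1 t2 by rewrite -aa; apply: glide_sqr_commute.
exists (aff_val \o phi); last by rewrite /= !phiE.
apply: (crystallographicP t12 phiM) => //; rewrite ?phiE //; last first.
  by rewrite /= !phiM !phiE (morph_one phiM).
have sta : stable t1 t2 [:: 1; a; c; a * c] a.
  apply: (stable_conj t12 (p := 1) (q := 0) (r := 0) (d := -1)).
  - by rewrite mulg1 -[t1 ^^ 1]/t1 -aa expg2 mulgA mulgK.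
  - by rewrite mul1g at_.
  have a_nf n x : x \in [:: 1; a; c; a * c] ->
      normal_form t1 t2 [:: 1; a; c; a * c] (t1 ^^ n * x).
    by exists n, 0%R, x; rewrite mulg1.
  move=> x; rewrite !inE => /or4P[]/eqP->.
  - rewrite mulg1; have := a_nf 0%R a; rewrite mul1g; apply.
    by rewrite !inE eqxx !orbT.
  - by rewrite -expg2 aa; have := a_nf 1%R 1; rewrite mulg1; apply; rewrite !inE eqxx.
  - have := a_nf 0%R (a * c); rewrite mul1g; apply.
    by rewrite !inE eqxx !orbT.
  - by rewrite mulgA -expg2 aa; apply: (a_nf 1%R); rewrite !inE eqxx !orbT.
have aV : a^-1 = t1 ^^ (-1) * a.
  by rewrite -[t1 ^^ (-1)]/(t1^-1) -aa expg2 invgM mulgVK.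
(* This exchange rule, from c a c^-1 = t2 a^-1 and a^-1 = t1^-1 a, moves [c] past [a]. *)
have cac : c * a = t1 ^^ (-1) * t2 ^^ 1 * (a * c).
  have -> : c * a = t2 * a^-1 * c by rewrite -ca mulgVK.
  rewrite aV !mulgA; congr (_ * _ * _).
  exact: (commute_zexpg (-1) (commute_sym t12)).
have stc : stable t1 t2 [:: 1; a; c; a * c] c.
  apply: (stable_conj t12 (p := -1) (q := 0) (r := 0) (d := -1)).
  - by rewrite mulg1 ct1.
  - by rewrite mul1g ct2.
  move=> x; rewrite !inE => /or4P[]/eqP->.
  - by exists 0%R, 0%R, c; rewrite !inE eqxx !orbT !mul1g mulg1.
  - by exists (-1)%R, 1%R, (a * c); rewrite !inE eqxx !orbT.
  - by exists 0%R, 0%R, 1; rewrite !inE eqxx -expg2 cc !mulg1.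
  - exists (-1)%R, 1%R, a; rewrite !inE eqxx !orbT; split=> //.
    by rewrite mulgA cac -!mulgA -expg2 cc mulg1.
apply: (normal_formT (S := [set a; c; t1; t2])) => //.
  by move=> H HH SH; apply: presented_gen => // -[]; apply: SH;
    [left; left; left | left; left; right | left; right | right].
have cV : c^-1 = c by apply: mulg1_eq; rewrite -expg2.
move=> _ [[[]|]|] -> .
- by rewrite aV; split=> //; apply: stableM => //; apply: stable_t1.
- by rewrite cV.
- by split; [apply: (stable_t1 t12 1) | apply: (stable_t1 t12 (-1))].
- by split; [apply: (stable_t2 t12 1) | apply: (stable_t2 t12 (-1))].
Qed.

(** * Structure and centralizers of the six groups *)

Theorem mainTheorem1 :
  (let a : G1 := pgen rels1 a_a in
   let t1 : G1 := pgen rels1 a_t1 in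
   let t2 : G1 := pgen rels1 a_t2 in
   let H : set G1 := generated [set t1; t2] in
   [/\ free_abelian_of_rank 2 H /\ finite_index H,
       isomorphic_to ZxZ H,
       isomorphic_to klein_group [set: G1],
       unique_form t1 t2 [:: 1; a] &
       forall (u : G1) (n1 n2 : int), u <> 1 ->
       [/\ u = t1 ^^ n1 * t2 ^^ n2 ->
             (generated [set t1] u -> centralizer u = [set: G1]) /\
             (~ generated [set t1] u -> centralizer u = H)
         & u = t1 ^^ n1 * t2 ^^ n2 * a ->
             centralizer u = generated [set t2 ^^ n2 * a]]]) /\
  (let c : G2 := pgen rels2 c_c in
   let t1 : G2 := pgen rels2 c_t1 in
   let t2 : G2 := pgen rels2 c_t2 in
   let H : set G2 := generated [set t1; t2] in
   [/\ free_abelian_of_rank 2 H /\ finite_index H,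
       isomorphic_to ZxZ H,
       unique_form t1 t2 [:: 1; c] &
       forall (u : G2) (n1 n2 : int), u <> 1 ->
       [/\ u = t1 ^^ n1 * t2 ^^ n2 -> centralizer u = H
         & u = t1 ^^ n1 * t2 ^^ n2 * c -> centralizer u = generated [set u]]]) /\
  (let c : G3 := pgen rels3 c_c in
   let t1 : G3 := pgen rels3 c_t1 in
   let t2 : G3 := pgen rels3 c_t2 in
   let H : set G3 := generated [set t1; t2] in
   [/\ free_abelian_of_rank 2 H /\ finite_index H,
       isomorphic_to ZxZ H,
       unique_form t1 t2 [:: 1; c; c ^+ 2] &
       forall (u : G3) (n1 n2 : int), u <> 1 ->
       [/\ u = t1 ^^ n1 * t2 ^^ n2 -> centralizer u = H,
           u = t1 ^^ n1 * t2 ^^ n2 * c -> centralizer u = generated [set u]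
         & u = t1 ^^ n1 * t2 ^^ n2 * c ^+ 2 ->
             centralizer u = generated [set t1 ^^ n2 * t2 ^^ (n2 - n1) * c]]]) /\
  (let c : G4 := pgen rels4 c_c in
   let t1 : G4 := pgen rels4 c_t1 in
   let t2 : G4 := pgen rels4 c_t2 in
   let H : set G4 := generated [set t1; t2] in
   [/\ free_abelian_of_rank 2 H /\ finite_index H,
       isomorphic_to ZxZ H,
       unique_form t1 t2 [:: 1; c; c ^+ 2; c ^+ 3] &
       forall (u : G4) (n1 n2 : int), u <> 1 ->
       [/\ u = t1 ^^ n1 * t2 ^^ n2 -> centralizer u = H,
           u = t1 ^^ n1 * t2 ^^ n2 * c -> centralizer u = generated [set u],
           u = t1 ^^ n1 * t2 ^^ n2 * c ^+ 2 ->
             centralizer u =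
               (if (2 %| (n1 + n2)%R)%Z
                then generated [set t1 ^^ ((n1 + n2)%R %/ 2)%Z
                                    * t2 ^^ ((n2 - n1)%R %/ 2)%Z * c]
                else generated [set u])
         & u = t1 ^^ n1 * t2 ^^ n2 * c ^+ 3 ->
             centralizer u = generated [set t1 ^^ n2 * t2 ^^ (- n1) * c]]]) /\
  (let c : G5 := pgen rels5 c_c in
   let t1 : G5 := pgen rels5 c_t1 in
   let t2 : G5 := pgen rels5 c_t2 in
   let H : set G5 := generated [set t1; t2] in
   [/\ free_abelian_of_rank 2 H /\ finite_index H,
       isomorphic_to ZxZ H,
       unique_form t1 t2 [:: 1; c; c ^+ 2; c ^+ 3; c ^+ 4; c ^+ 5] &
       forall (u : G5) (n1 n2 : int), u <> 1 ->
       (u = t1 ^^ n1 * t2 ^^ n2 -> centralizer u = H) /\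
       [/\ u = t1 ^^ n1 * t2 ^^ n2 * c -> centralizer u = generated [set u],
           u = t1 ^^ n1 * t2 ^^ n2 * c ^+ 2 ->
             centralizer u =
               (if (3 %| (n1 - n2)%R)%Z
                then generated [set t1 ^^ ((2 * n1 + n2)%R %/ 3)%Z
                                    * t2 ^^ ((n2 - n1)%R %/ 3)%Z * c]
                else generated [set u]),
           u = t1 ^^ n1 * t2 ^^ n2 * c ^+ 3 ->
             centralizer u =
               (if (2 %| n1)%Z && (2 %| n2)%Z
                then generated [set t1 ^^ ((n1 + n2)%R %/ 2)%Z
                                    * t2 ^^ (- (n1 %/ 2)%Z) * c]
                else generated [set u]),
           u = t1 ^^ n1 * t2 ^^ n2 * c ^+ 4 ->
             centralizer u =
               (if (3 %| (n1 - n2)%R)%Z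
                then generated [set t1 ^^ ((n1 + 2 * n2)%R %/ 3)%Z
                                    * t2 ^^ (- ((2 * n1 + n2)%R %/ 3)%Z) * c]
                else generated [set t1 ^^ (n1 + n2) * t2 ^^ (- n1) * c ^+ 2])
         & u = t1 ^^ n1 * t2 ^^ n2 * c ^+ 5 ->
             centralizer u =
               generated [set t1 ^^ n2 * t2 ^^ (- (n1 + n2)) * c]]]) /\
  (let a : G6 := pgen rels6 ac_a in
   let c : G6 := pgen rels6 ac_c in
   let t1 : G6 := pgen rels6 ac_t1 in
   let t2 : G6 := pgen rels6 ac_t2 in
   let H : set G6 := generated [set t1; t2] in
   let K : set G6 := generated [set a; t1; t2] in
   [/\ free_abelian_of_rank 2 H /\ finite_index H,
       isomorphic_to ZxZ H,
       isomorphic_to klein_group K /\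
         isomorphic_to klein_group (generated [set a * c; t1]),
       unique_form t1 t2 [:: 1; a; c; a * c] &
       forall (u : G6) (n1 n2 : int), u <> 1 ->
       [/\ u = t1 ^^ n1 * t2 ^^ n2 ->
             [/\ generated [set t2] u ->
                   centralizer u = generated [set a * c; t1],
                 generated [set t1] u -> centralizer u = K
               & ~ generated [set t2] u /\ ~ generated [set t1] u ->
                   centralizer u = H],
           u = t1 ^^ n1 * t2 ^^ n2 * a ->
             centralizer u = generated [set t2 ^^ n2 * a],
           u = t1 ^^ n1 * t2 ^^ n2 * c -> centralizer u = generated [set u]
         & u = t1 ^^ n1 * t2 ^^ n2 * (a * c) ->
             centralizer u = generated [set t1 ^^ n1 * (a * c)]]]).
Proof.
split.
{ move=> a t1 t2 H.
  have [rep cr ra] := G1_crystallographic; have [fi iso uf] := cr_generators cr.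
  have repaM n1 n2 := etrans (rep_latM cr n1 n2 a) (congr1 _ ra).
  have [aa at_] : a ^+ 2 = t1 /\ a * t2 * a^-1 = t2^-1 := G1_relations.
  split=> //.
    (* As t1 = a^2, the whole group is generated by the glide [a] and the element [t2] that it
       inverts. *)
    have <- : generated [set a; t2] = setT.
      apply/seteqP; split=> // g _; move: g.
      apply: presented_gen; first exact: generated_subgroup.
      have ga : generated [set a; t2] a by apply: mem_generated; left.
      case=> //; last by apply: mem_generated; right.
      by rewrite -[pgen _ _]/t1 -aa; apply: (generatedX (Posz 2)).
    apply: isomorphic_to_klein => //; rewrite aa => n1 n2.
      by move=> /(cr_lat_eq1 cr).
    move/(congr1 (linear_part \o rep)).
    by rewrite /= (linear_part_lat cr) (rep_one cr) ra.
  move=> u n1 n2 u1; split=> eu; rewrite eu in u1 *.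
    have n0 := lat_neq1 u1; rewrite (mem_generated_t1 cr); split=> n20.
      rewrite n20 mulg1; apply/seteqP; split=> // g _; move: g.
      apply: presented_gen; first exact: centralizer_subgroup.
      case; rewrite /centralizer /=; apply: commute_zexpg; rewrite -/t1 //.
        by rewrite -aa; apply: commuteX.
      exact/commute_sym/(cr_comm cr).
    apply: (centralizer_lat cr) => x; rewrite !inE => /orP[]/eqP-> //.
    move=> /(commute_repP cr); rewrite (cr_lat cr) ra => e.
    exfalso; apply: n20; move: e; equations_tac.
  (* The exponent 0 brings the claimed generator to normal form, on which [rep] can be evaluated. *)
  have wE : t2 ^^ n2 * a = t1 ^^ 0 * t2 ^^ n2 * a by rewrite mul1g.
  apply: (centralizer_cycle cr).
  - apply/(commute_repP cr); rewrite wE !repaM; equations_tac.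
  - move=> p q /(commute_repP cr); rewrite repaM (cr_lat cr) => e.
    (* A translation commuting with [u] is a power of [t1], which is the square of the claimed
       generator because [a] inverts [t2]. *)
    have -> : q = 0%R by move: e; equations_tac.
    have w2 : t2 ^^ n2 * a * (t2 ^^ n2 * a) = t1.
      apply: (cr_inj cr); rewrite (cr_repM cr) wE repaM -[t1]mulg1.
      rewrite -[t1 * 1]/(t1 ^^ 1 * t2 ^^ 0) (cr_lat cr); equations_tac.
    rewrite mulg1; apply: generatedX; rewrite -[pgen _ _]/t1 -w2.
    by apply: generatedM; apply: mem_generated.
  - move=> p q x; rewrite !inE => /orP[]/eqP-> _; first by exists 0%N.
    by exists 1%N; rewrite expg1 wE (linear_part_lat cr). }
split.
{ move=> c t1 t2 H.
  have [rep cr rc] := G2_crystallographic.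
  have [? ? ?] := cr_generators cr; have cyc := cyclic_centralizer_cycle cr rc.
  split=> // u n1 n2 u1; split=> e.
    by apply: (cyclic_centralizer_lat cr rc u1 e); lat_tac.
  (* The two numerals are the exponents of [c] in [u] and in the claimed generator. *)
  by rewrite e; apply: (cyc _ _ 1%N 1%N _ _ _ _ erefl erefl); cycle_tac. }
split.
{ move=> c t1 t2 H.
  have [rep cr rc] := G3_crystallographic.
  have [? ? ?] := cr_generators cr; have cyc := cyclic_centralizer_cycle cr rc.
  split=> // u n1 n2 u1; split=> e.
  + by apply: (cyclic_centralizer_lat cr rc u1 e); lat_tac.
  + by rewrite e; apply: (cyc _ _ 1%N 1%N _ _ _ _ erefl erefl); cycle_tac.
  (* The claimed generator is u^-1, rewritten with c^3 = 1. *)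
  + by rewrite e; apply: (cyc _ _ 2%N 1%N _ _ _ _ erefl erefl); cycle_tac. }
split.
{ move=> c t1 t2 H.
  have [rep cr rc] := G4_crystallographic.
  have [? ? ?] := cr_generators cr; have cyc := cyclic_centralizer_cycle cr rc.
  split=> // u n1 n2 u1; split=> e.
  + by apply: (cyclic_centralizer_lat cr rc u1 e); lat_tac.
  + by rewrite e; apply: (cyc _ _ 1%N 1%N _ _ _ _ erefl erefl); cycle_tac.
  (* The exponents of w = t1^a t2^b c solve w^2 = u, that is a - b = n1 and a + b = n2, which is
     solvable in integers exactly when n1 + n2 is even. *)
  + rewrite e; case: ifP => h.
      by apply: (cyc _ _ 2%N 1%N _ _ _ _ erefl erefl); cycle_tac.
    by apply: (cyc _ _ 2%N 2%N _ _ _ _ erefl erefl); cycle_tac.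
  (* The claimed generator is u^-1. *)
  + by rewrite e; apply: (cyc _ _ 3%N 1%N _ _ _ _ erefl erefl); cycle_tac. }
split.
{ move=> c t1 t2 H.
  have [rep cr rc] := G5_crystallographic.
  have [? ? ?] := cr_generators cr; have cyc := cyclic_centralizer_cycle cr rc.
  split=> // u n1 n2 u1; split=> [e|].
    by apply: (cyclic_centralizer_lat cr rc u1 e); lat_tac.
  split=> e; rewrite e.
  + by apply: (cyc _ _ 1%N 1%N _ _ _ _ erefl erefl); cycle_tac.
  (* Now w^2 = u reads a - b = n1 and a + 2 b = n2. *)
  + case: ifP => h.
      by apply: (cyc _ _ 2%N 1%N _ _ _ _ erefl erefl); cycle_tac.
    by apply: (cyc _ _ 2%N 2%N _ _ _ _ erefl erefl); cycle_tac.
  (* Here w^3 = u reads - 2 b = n1 and 2 a + 2 b = n2. *)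
  + case: ifP => h.
      by apply: (cyc _ _ 3%N 1%N _ _ _ _ erefl erefl); cycle_tac.
    by apply: (cyc _ _ 3%N 3%N _ _ _ _ erefl erefl); cycle_tac.
  (* Here w^4 = u reads - a - 2 b = n1 and 2 a + b = n2; without an integral solution the generator
     is u^-1, which lies over c^2. *)
  + case: ifP => h.
      by apply: (cyc _ _ 4%N 1%N _ _ _ _ erefl erefl); cycle_tac.
    by apply: (cyc _ _ 4%N 2%N _ _ _ _ erefl erefl); cycle_tac.
  (* The claimed generator is u^-1. *)
  + by apply: (cyc _ _ 5%N 1%N _ _ _ _ erefl erefl); cycle_tac. }
move=> a c t1 t2 H K.
have [rep] : exists2 rep, crystallographic t1 t2 [:: 1; a; c; a * c] rep & _ :=
  G6_crystallographic.
move=> cr [ra rc]; have [fi iso uf] := cr_generators cr.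
have [aa cc at_ [ct1 ct2 ca]] : [/\ a ^+ 2 = t1, c ^+ 2 = 1,
    a * t2 * a^-1 = t2^-1 & [/\ c * t1 * c^-1 = t1^-1, c * t2 * c^-1 = t2^-1
    & c * a * c^-1 = t2 * a^-1]] := G6_relations.
have rac : rep (a * c) = (1, -1, -1, 0, 0, 1)%R.
  by rewrite (cr_repM cr) ra rc.
have repE := (rep_latM cr, cr_lat cr, ra, rc, rac).
have rt1 : rep t1 = (2, 0, 1, 0, 0, 1)%R.
  by rewrite -[t1]mulg1 -[t1 * 1]/(t1 ^^ 1 * t2 ^^ 0) (cr_lat cr).
(* The product [a * c] is a second glide, along the direction of [t2]. *)
have ac2 : a * c * (a * c) = t2^-1.
  apply: (cr_inj cr); rewrite -[t2^-1]mul1g.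
  rewrite -[1 * t2^-1]/(t1 ^^ 0 * t2 ^^ (-1)) (cr_repM cr) !repE; equations_tac.
have commE x y := commute_repP cr x y.
have t12 : commute t1 t2 := cr_comm cr.
(* The generator t1 = a^2 is dropped to reach the two-generator form of the Klein bottle group. *)
have KE : generated [set a; t2] = K.
  apply/seteqP; split; apply: generated_min (generated_subgroup _) _.
    by move=> _ [] ->; apply: mem_generated; [left; left | right].
  have ga : generated [set a; t2] a by apply: mem_generated; left.
  move=> _ [[]|] -> //; last by apply: mem_generated; right.
  by rewrite -aa; apply: (generatedX (Posz 2)).
split=> //.
  split.
    rewrite -KE; apply: isomorphic_to_klein => //; rewrite aa => n1 n2.
      by move=> /(cr_lat_eq1 cr).
    move/(congr1 (linear_part \o rep)).
    by rewrite /= (linear_part_lat cr) (rep_one cr) ra.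
  (* For the second Klein bottle subgroup the glide is [a * c] and the inverted element is [t1], so
     the roles of [t1] and [t2] are exchanged. *)
  have acE n1 n2 : ((a * c) ^+ 2) ^^ n1 * t1 ^^ n2 = t1 ^^ n2 * t2 ^^ (- n1).
    rewrite expg2 ac2 zexpVg.
    by apply/commute_zexpg/commute_sym/commute_zexpg.
  apply: isomorphic_to_klein => [|n1 n2|n1 n2]; rewrite ?acE.
  - apply: (canLR (mulgK _)); apply: (cr_inj cr).
    rewrite -[t1^-1]mulg1 -[t1^-1 * 1]/(t1 ^^ (-1) * t2 ^^ 0).
    by rewrite (cr_repM cr) !repE rt1; equations_tac.
  - by move=> /(cr_lat_eq1 cr)[-> /eqP]; rewrite GRing.oppr_eq0 => /eqP.
  - move/(congr1 (linear_part \o rep)).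
    by rewrite /= (linear_part_lat cr) (rep_one cr) rac.
have not_comm x y : (affine_mul (rep x) (rep y) = affine_mul (rep y) (rep x) ->
  False) -> ~ commute x y by rewrite -commE.
have glat S n1 n2 : generated S t1 -> generated S t2 ->
    generated S (t1 ^^ n1 * t2 ^^ n2).
  by move=> S1 S2; apply: generatedM; apply: generatedX.
move=> u n1 n2 u1; split=> eu; rewrite eu in u1 *.
- have n0 := lat_neq1 u1.
  split=> [/(mem_generated_t2 cr) n10|/(mem_generated_t1 cr) n20|[nt2 nt1]].
  + have gac : generated [set a * c; t1] (a * c) by apply: mem_generated; left.
    have gt1 : generated [set a * c; t1] t1 by apply: mem_generated; right.
    have gt2 : generated [set a * c; t1] t2.
      by rewrite -[t2]invgK -ac2; apply: generatedV; apply: generatedM.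
    apply: (centralizer_generated cr) => [_ [] ->|p q x].
    * by apply/commE; rewrite !repE; equations_tac.
    * by apply/commE; rewrite !repE rt1; equations_tac.
    (* Both [a] and [c] invert [t2], so no element over them centralizes a nontrivial power of
       [t2]. *)
    rewrite !inE => /or4P[]/eqP-> => [_|/not_comm[]|/not_comm[]|_].
    * by rewrite mulg1; apply: glat.
    * by rewrite !repE; equations_tac.
    * by rewrite !repE; equations_tac.
    * by apply: generatedM gac; apply: glat.
  + have ga : K a by apply: mem_generated; left; left.
    have gt1 : K t1 by apply: mem_generated; left; right.
    have gt2 : K t2 by apply: mem_generated; right.
    apply: (centralizer_generated cr) => [x Kx|p q x].
      suff : K `<=` centralizer (t1 ^^ n1 * t2 ^^ n2) by apply; apply: mem_generated.
      rewrite -KE; apply: generated_min (centralizer_subgroup _) _.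
      move=> _ [] ->; last by rewrite n20 mulg1; apply/commute_zexpg/commute_sym.
      by apply/commE; rewrite !repE; equations_tac.
    (* Both [c] and [a * c] invert [t1]. *)
    rewrite !inE => /or4P[]/eqP-> => [_|_|/not_comm[]|/not_comm[]].
    * by rewrite mulg1; apply: glat.
    * by apply: generatedM ga; apply: glat.
    * by rewrite !repE; equations_tac.
    * by rewrite !repE; equations_tac.
  + have n10 : n1 <> 0%R by move=> e; apply/nt2/(mem_generated_t2 cr).
    have n20 : n2 <> 0%R by move=> e; apply/nt1/(mem_generated_t1 cr).
    apply: (centralizer_lat cr) => x; rewrite !inE.
    move=> /or4P[]/eqP-> // /not_comm[]; rewrite !repE; equations_tac.
- have wE : t2 ^^ n2 * a = t1 ^^ 0 * t2 ^^ n2 * a by rewrite mul1g.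
  have w2 : t2 ^^ n2 * a * (t2 ^^ n2 * a) = t1.
    by apply: (cr_inj cr); rewrite (cr_repM cr) wE !repE rt1; equations_tac.
  have gt1 : generated [set t2 ^^ n2 * a] t1.
    by rewrite -w2; apply: generatedM; apply: mem_generated.
  apply: (centralizer_cycle cr).
  + by apply/commE; rewrite wE !repE; equations_tac.
  + move=> p q /commE; rewrite !repE => e.
    have -> : q = 0%R by move: e; equations_tac.
    by rewrite mulg1; apply: generatedX.
  (* Elements over [c] and [a * c] reverse the first axis, so commuting with [u] would force its odd
     translation coordinate 2 n1 + 1 to vanish. *)
  + move=> p q x; rewrite !inE => /or4P[]/eqP-> => [_|_|/not_comm[]|/not_comm[]].
    * by exists 0%N.
    * by exists 1%N; rewrite expg1 wE (linear_part_lat cr).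
    * by rewrite !repE; equations_tac.
    * by rewrite !repE; equations_tac.
- apply: (centralizer_cycle cr) => [//|p q /commE|p q x].
    rewrite !repE => e.
    have -> : p = 0%R by move: e; equations_tac.
    have -> : q = 0%R by move: e; equations_tac.
    by rewrite mulg1; case: (generated_subgroup [set t1 ^^ n1 * t2 ^^ n2 * c]).
  (* Conjugation by the half-turn [u] negates the odd translation of a glide along its axis, which
     excludes elements over [a] and [a * c]. *)
  rewrite !inE => /or4P[]/eqP-> => [_|/not_comm[]|_|/not_comm[]].
  + by exists 0%N.
  + by rewrite !repE; equations_tac.
  + by exists 1%N; rewrite expg1 (linear_part_lat cr).
  + by rewrite !repE; equations_tac.
- have wE : t1 ^^ n1 * (a * c) = t1 ^^ n1 * t2 ^^ 0 * (a * c) by rewrite mulg1.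
  have w2 : t1 ^^ n1 * (a * c) * (t1 ^^ n1 * (a * c)) = t2^-1.
    rewrite -ac2; apply: (cr_inj cr).
    by rewrite (cr_repM cr) wE !repE (cr_repM cr (a * c)) rac; equations_tac.
  have gt2 : generated [set t1 ^^ n1 * (a * c)] t2.
    rewrite -[t2]invgK -w2; apply: generatedV.
    by apply: generatedM; apply: mem_generated.
  apply: (centralizer_cycle cr).
  + by apply/commE; rewrite wE !repE; equations_tac.
  + move=> p q /commE; rewrite !repE => e.
    have -> : p = 0%R by move: e; equations_tac.
    by rewrite mul1g; apply: generatedX.
  (* Elements over [a] and [c] reverse the second axis, where [u] has the odd translation coordinate
     2 n2 - 1. *)
  + move=> p q x; rewrite !inE => /or4P[]/eqP-> => [_|/not_comm[]|/not_comm[]|_].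
    * by exists 0%N.
    * by rewrite !repE; equations_tac.
    * by rewrite !repE; equations_tac.
    * by exists 1%N; rewrite expg1 wE (linear_part_lat cr).
Qed.
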